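(* Let $k$ be an algebraically closed field, let $T$ be a maximal torus of $SL_{n+1}(k)$, let $B_{n+1}$ be a Borel subgroup of $GL_{n+1}(k)$ containing $T$ with simple roots $\alpha_1,\dots,\alpha_n$, and let $W=S_{n+1}$ be the Weyl group. Let $\mathfrak{h}_n$ be a Cartan subalgebra of $\mathfrak{sl}_{n+1}(k)$. Let $\chi=\sum_{i=1}^n m_i\alpha_i$ be a regular dominant character with $m_i\in\mathbb{N}$ and $m_{i+1}>m_i$ for $1\le i\le n-1$. Then the action of $W$ on the GIT quotient $${}_{T}\backslash\backslash \big(GL_{n+1}(k)/B_{n+1}\big)^{ss}(L_\chi)\ \simeq\ GL_n(k)/B_n$$ is given by the $n$-dimensional representation $\mathfrak{h}_n$ of $W$.
   Context: The simple roots $S=\{\alpha_1,\dots,\alpha_n\}$ are numbered in the order of the vertices of the Dynkin diagram of type $A_n$. A character $\chi$ is regular dominant if $\langle\chi,\check{\alpha}_i\rangle>0$ for all $i$. $L_\chi$ is the ($T$-linearised) line bundle on $GL_{n+1}(k)/B_{n+1}$ associated with $\chi$; $(\cdot)^{ss}(L_\chi)$ is the set of semi-stable points for the action of $T$ with respect to $L_\chi$, and ${}_T\backslash\backslash(\cdot)^{ss}(L_\chi)$ is the GIT quotient. With $N$ the normaliser of $T$ in $SL_{n+1}(k)$, the group $W=N/T$ acts on this quotient through the action of $N$ on $GL_{n+1}(k)/B_{n+1}$. $GL_n(k)$ is viewed as a subgroup of $GL_{n+1}(k)$ via $g\mapsto \begin{pmatrix} g&0\\0&1\end{pmatrix}$,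 and $B_n=B_{n+1}\cap GL_n(k)$, a Borel subgroup of $GL_n(k)$ with simple roots $S\setminus\{\alpha_n\}$. For such $\chi$ the quotient is isomorphic to the flag variety $GL_n(k)/B_n$. $W$ acts on $\mathfrak{h}_n$ as the Weyl group (the standard representation of $S_{n+1}$). *)

(* Defs.v *)
From HB Require Import structures.
From mathcomp Require Import all_boot all_order all_algebra.
From mathcomp Require Import all_classical.
From mathcomp Require Import topology_structure initial_topology.
From mathcomp Require Import subtype_topology quotient_topology.
From mathcomp Require Import mpoly.

Set Implicit Arguments.
Unset Strict Implicit.
Unset Printing Implicit Defensive.

Import GRing.Theory Num.Theory.

Local Open Scope classical_set_scope.
Local Open Scope ring_scope.
Local Open Scope quotient_scope.

(******************************************************************************)
(* Classical varieties over an algebraically closed field k are treated as    *)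
(* spaces with functions: a topological space with a sheaf of k-valued        *)
(* functions.  Functions are total; [regular U f] says that the restriction   *)
(* of f to the open set U is a section of the structure sheaf over U, and the *)
(* values of f outside U are irrelevant (this is part of regular_local).      *)
(******************************************************************************)

HB.mixin Record isSpaceWithFunctions (k : fieldType) T of Topological T := {
  regular : set T -> (T -> k) -> Prop;
  regular_cst : forall (U : set T) (c : k), open U -> regular U (fun=> c);
  regularD : forall (U : set T) (f g : T -> k), open U ->
    regular U f -> regular U g -> regular U (fun x => f x + g x);
  regularM : forall (U : set T) (f g : T -> k), open U ->
    regular U f -> regular U g -> regular U (fun x => f x * g x);
  regularV : forall (U : set T) (f : T -> k), open U -> regular U f ->
    open (U `&` [set x | f x != 0]) /\
    regular (U `&` [set x | f x != 0]) (fun x => (f x)^-1);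
  regular_local : forall (U : set T) (f : T -> k), open U ->
    (forall x, U x -> exists (V : set T) (g : T -> k),
       [/\ open V, V x, regular V g & forall y, U y -> V y -> f y = g y]) ->
    regular U f
}.

#[short(type="spaceWithFunctions")]
HB.structure Definition SpaceWithFunctions (k : fieldType) :=
  {T of isSpaceWithFunctions k T & Topological T}.

Section Morphisms.
Variable k : fieldType.

Definition morphism (X Y : spaceWithFunctions k) (f : X -> Y) : Prop :=
  continuous f /\
  forall (V : set Y) (h : Y -> k), open V -> regular V h ->
    regular (f @^-1` V) (h \o f).

Definition isomorphism (X Y : spaceWithFunctions k) (f : X -> Y) : Prop :=
  morphism f /\ exists g : Y -> X, [/\ morphism g, cancel f g & cancel g f].

End Morphisms.

(* The affine space of p x q matrices, with its Zariski topology.             *)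
Definition affine_space (k : fieldType) (p q : nat) : Type := 'M[k]_(p, q).

Section AffineSpace.
Variables (k : fieldType) (p q : nat).
Local Notation A := (affine_space k p q).

HB.instance Definition _ := Choice.on A.

Definition poly_eval (s : {mpoly k[p * q]}) (a : A) : k :=
  s.@[fun i => mxvec a 0 i].

Definition zariski_open (U : set A) : Prop :=
  exists S : set {mpoly k[p * q]},
    U = [set a | exists2 s, S s & poly_eval s a != 0].

Let openT : zariski_open setT.
Proof.
exists setT; apply/seteqP; split=> // a _ /=.
by exists 1 => //; rewrite /poly_eval meval1 oner_eq0.
Qed.

Let openI U V : zariski_open U -> zariski_open V -> zariski_open (U `&` V).
Proof.
move=> [S ->] [S' ->].
exists [set r | exists s t, [/\ S s, S' t & r = s * t]].
apply/seteqP; split=> a /=.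
  move=> [[s Ss sa] [t St ta]]; exists (s * t); first by exists s, t.
  by rewrite /poly_eval mevalM mulf_neq0.
move=> [_ [s [t [Ss St ->]]]]; rewrite /poly_eval mevalM mulf_eq0 negb_or.
by case/andP=> sa ta; split; [exists s|exists t].
Qed.

Let open_bigU (I : Type) (f : I -> set A) :
  (forall i, zariski_open (f i)) -> zariski_open (\bigcup_i f i).
Proof.
move=> /choice[S fS]; exists (\bigcup_i S i); apply/seteqP; split=> a /=.
  by move=> [i _]; rewrite (fS i) => -[s Ss sa]; exists s => //; exists i.
by move=> [s [i _ Ss] sa]; exists i => //; rewrite (fS i); exists s.
Qed.

HB.instance Definition _ := isOpenTopological.Build A openT openI open_bigU.

(* Regular functions are locally quotients of polynomials.                    *)
Definition affine_regular (U : set A) (f : A -> k) : Prop :=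
  forall a, U a -> exists s t : {mpoly k[p * q]}, poly_eval t a != 0 /\
    forall a', U a' -> poly_eval t a' != 0 ->
      f a' = poly_eval s a' / poly_eval t a'.

Let reg_cst_subproof (U : set A) (c : k) : open U -> affine_regular U (fun=> c).
Proof.
move=> _ a _; exists c%:MP, 1; rewrite /poly_eval meval1 oner_eq0; split=> //.
by move=> a' _ _; rewrite mevalC meval1 divr1.
Qed.

Let regD_subproof (U : set A) (f g : A -> k) : open U ->
  affine_regular U f -> affine_regular U g ->
  affine_regular U (fun x => f x + g x).
Proof.
move=> _ rf rg a Ua; have [s [t [ta ft]]] := rf a Ua.
have [s' [t' [ta' gt]]] := rg a Ua.
exists (s * t' + s' * t), (t * t').
rewrite /poly_eval mevalM mulf_neq0 //; split=> // b Ub.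
rewrite mevalM mulf_eq0 negb_or => /andP[tb tb'].
by rewrite (ft b) // (gt b) // /poly_eval mevalD !mevalM addf_div.
Qed.

Let regM_subproof (U : set A) (f g : A -> k) : open U ->
  affine_regular U f -> affine_regular U g ->
  affine_regular U (fun x => f x * g x).
Proof.
move=> _ rf rg a Ua; have [s [t [ta ft]]] := rf a Ua.
have [s' [t' [ta' gt]]] := rg a Ua.
exists (s * s'), (t * t').
rewrite /poly_eval mevalM mulf_neq0 //; split=> // b Ub.
rewrite mevalM mulf_eq0 negb_or => /andP[tb tb'].
by rewrite (ft b) // (gt b) // /poly_eval !mevalM mulf_div.
Qed.

Let regV_subproof (U : set A) (f : A -> k) : open U -> affine_regular U f ->
  open (U `&` [set x | f x != 0]) /\
  affine_regular (U `&` [set x | f x != 0]) (fun x => (f x)^-1).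
Proof.
move=> [S US] rf; split.
  exists [set r | exists s t u, [/\ S u, r = s * t * u &
            forall a, U a -> poly_eval t a != 0 ->
              f a = poly_eval s a / poly_eval t a]].
  apply/seteqP; split=> a /=.
    move=> [Ua fa]; have [s [t [ta ft]]] := rf a Ua.
    have [u Su ua] : exists2 u, S u & poly_eval u a != 0 by rewrite US in Ua.
    exists (s * t * u); first by exists s, t, u.
    rewrite /poly_eval !mevalM !mulf_neq0 //.
    by apply: contra_neq fa; rewrite (ft a) // => sa; rewrite /poly_eval sa mul0r.
  move=> [_ [s [t [u [Su -> ft]]]]].
  rewrite /poly_eval !mevalM !mulf_eq0 !negb_or -andbA => /and3P[sa ta ua].
  have Ua : U a by rewrite US; exists u.
  by split=> //; rewrite (ft a) // mulf_neq0 // invr_neq0.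
move=> a [Ua /= fa]; have [s [t [ta ft]]] := rf a Ua.
have sa : poly_eval s a != 0.
  by apply: contra_neq fa; rewrite (ft a) // => ->; rewrite mul0r.
exists (t * t), (s * t); rewrite /poly_eval mevalM mulf_neq0 //; split=> //.
move=> b [Ub _]; rewrite mevalM mulf_eq0 negb_or => /andP[sb tb].
by rewrite (ft b) // /poly_eval !mevalM invf_div -mulf_div divff // mulr1.
Qed.

Let reg_local_subproof (U : set A) (f : A -> k) : open U ->
  (forall x, U x -> exists (V : set A) (g : A -> k),
     [/\ open V, V x, affine_regular V g &
         forall y, U y -> V y -> f y = g y]) ->
  affine_regular U f.
Proof.
move=> _ loc a Ua; have [V [g [[S VS] Va rg fg]]] := loc a Ua.
have [s [t [ta gt]]] := rg a Va; move: (Va); rewrite VS => -[u Su ua].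
exists (s * u), (t * u); rewrite /poly_eval mevalM mulf_neq0 //; split=> // b Ub.
rewrite mevalM mulf_eq0 negb_or => /andP[tb ub].
have Vb : V b by rewrite VS; exists u.
by rewrite fg // (gt b) // /poly_eval !mevalM -mulf_div divff // mulr1.
Qed.

HB.instance Definition _ := isSpaceWithFunctions.Build k A
  reg_cst_subproof regD_subproof regM_subproof regV_subproof
  reg_local_subproof.

End AffineSpace.

(* A subset of a space with functions, with the induced topology; a function  *)
(* is regular if it is locally the restriction of a regular function.         *)
Section Subspace.
Variables (k : fieldType) (X : spaceWithFunctions k) (S : set X).

Definition sub_regular (U : set S) (f : S -> k) : Prop :=
  forall x, U x -> exists (V : set X) (g : X -> k),
    [/\ open V, V (val x), regular V g &
        forall y, U y -> V (val y) -> f y = g (val y)].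

Let reg_cst_subproof (U : set S) (c : k) : open U -> sub_regular U (fun=> c).
Proof.
move=> _ x _; exists setT, (fun=> c); split=> //; first exact: openT.
exact/regular_cst/openT.
Qed.

Let restr (U V : set X) (f : X -> k) : open U -> open V ->
  V `<=` U -> regular U f -> regular V f.
Proof.
by move=> oU oV VU rf; apply: regular_local => // x Vx; exists U, f; split=> //; exact: VU.
Qed.

Let regD_subproof (U : set S) (f g : S -> k) : open U ->
  sub_regular U f -> sub_regular U g -> sub_regular U (fun x => f x + g x).
Proof.
move=> _ rf rg x Ux; have [V [f' [oV Vx rf' ff']]] := rf x Ux.
have [W [g' [oW Wx rg' gg']]] := rg x Ux.
have oVW := openI oV oW.
exists (V `&` W), (fun x => f' x + g' x); split=> //.
  by apply: regularD => //; [apply: restr rf'|apply: restr rg'] => // y [].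
by move=> y Uy [Vy Wy]; rewrite ff' // gg'.
Qed.

Let regM_subproof (U : set S) (f g : S -> k) : open U ->
  sub_regular U f -> sub_regular U g -> sub_regular U (fun x => f x * g x).
Proof.
move=> _ rf rg x Ux; have [V [f' [oV Vx rf' ff']]] := rf x Ux.
have [W [g' [oW Wx rg' gg']]] := rg x Ux.
have oVW := openI oV oW.
exists (V `&` W), (fun x => f' x * g' x); split=> //.
  by apply: regularM => //; [apply: restr rf'|apply: restr rg'] => // y [].
by move=> y Uy [Vy Wy]; rewrite ff' // gg'.
Qed.

Let regV_subproof (U : set S) (f : S -> k) : open U -> sub_regular U f ->
  open (U `&` [set x | f x != 0]) /\
  sub_regular (U `&` [set x | f x != 0]) (fun x => (f x)^-1).
Proof.
move=> oU rf; split.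
  have [U' oU' UU'] := oU.
  exists (\bigcup_(V in [set V | open V /\
             forall y : S, V (val y) -> U y /\ f y != 0]) V).
    by apply: bigcup_open => V [].
  apply/seteqP; split=> x /=; first by move=> [V [_ VU] /VU].
  move=> [Ux fx]; have [V [f' [oV Vx rf' ff']]] := rf x Ux.
  have [oV' _] := regularV _ _ oV rf'.
  exists (U' `&` (V `&` [set z | f' z != 0])); last first.
    split; first by rewrite -UU' in Ux.
    by split=> //=; rewrite -ff'.
  split; first exact: openI.
  move=> y [U'y [Vy /= f'y]].
  have Uy : U y by rewrite -UU'.
  by rewrite ff'.
move=> x [Ux /= fx]; have [V [f' [oV Vx rf' ff']]] := rf x Ux.
have [oV' rV'] := regularV _ _ oV rf'.
exists (V `&` [set z | f' z != 0]), (fun z => (f' z)^-1); split=> //.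
  by split=> //=; rewrite -ff'.
by move=> y [Uy _] [Vy _]; rewrite ff'.
Qed.

Let reg_local_subproof (U : set S) (f : S -> k) : open U ->
  (forall x, U x -> exists (V : set S) (g : S -> k),
     [/\ open V, V x, sub_regular V g & forall y, U y -> V y -> f y = g y]) ->
  sub_regular U f.
Proof.
move=> oU loc x Ux; have [V [g [[V' oV' VV'] Vx rg fg]]] := loc x Ux.
have [W [h [oW Wx rh gh]]] := rg x Vx.
have oVW := openI oV' oW.
exists (V' `&` W), h; split=> //; first by split=> //; rewrite -VV' in Vx.
  by apply: restr rh => // y [].
move=> y Uy [V'y Wy]; have Vy : V y by rewrite -VV'.
by rewrite fg // gh.
Qed.

HB.instance Definition _ := isSpaceWithFunctions.Build k (set_type S)
  reg_cst_subproof regD_subproof regM_subproof regV_subproof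
  reg_local_subproof.

End Subspace.

(* The quotient of a space with functions by an equivalence relation: open    *)
(* sets and regular functions are those which pull back to such.              *)
Section Quotient.
Variables (k : fieldType) (X : spaceWithFunctions k) (Q0 : quotType X).
Local Notation Q := (quotient_topology Q0).

Definition quot_regular (U : set Q) (f : Q -> k) : Prop :=
  regular (\pi_Q @^-1` U) (f \o \pi_Q).

Let reg_cst_subproof (U : set Q) (c : k) : open U -> quot_regular U (fun=> c).
Proof. by move=> oU; apply: regular_cst. Qed.

Let regD_subproof (U : set Q) (f g : Q -> k) : open U ->
  quot_regular U f -> quot_regular U g -> quot_regular U (fun x => f x + g x).
Proof. by move=> oU; apply: regularD. Qed.

Let regM_subproof (U : set Q) (f g : Q -> k) : open U ->
  quot_regular U f -> quot_regular U g -> quot_regular U (fun x => f x * g x).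
Proof. by move=> oU; apply: regularM. Qed.

Let regV_subproof (U : set Q) (f : Q -> k) : open U -> quot_regular U f ->
  open (U `&` [set x | f x != 0]) /\
  quot_regular (U `&` [set x | f x != 0]) (fun x => (f x)^-1).
Proof. by move=> oU rf; have := regularV (\pi_Q @^-1` U) _ oU rf. Qed.

Let reg_local_subproof (U : set Q) (f : Q -> k) : open U ->
  (forall x, U x -> exists (V : set Q) (g : Q -> k),
     [/\ open V, V x, quot_regular V g & forall y, U y -> V y -> f y = g y]) ->
  quot_regular U f.
Proof.
move=> oU loc; apply: regular_local => // x Ux.
have [V [g [oV Vx rg fg]]] := loc _ Ux.
by exists (\pi_Q @^-1` V), (g \o \pi_Q); split=> // y Uy Vy; exact: fg.
Qed.

HB.instance Definition _ := isSpaceWithFunctions.Build k Q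
  reg_cst_subproof regD_subproof regM_subproof regV_subproof
  reg_local_subproof.

End Quotient.

Section GoodQuotient.
Variable k : fieldType.

(* Isomorphic to a Zariski closed subset of some affine space.                *)
Definition affine (X : spaceWithFunctions k) : Prop :=
  exists (p q : nat) (Z : set (affine_space k p q)) (f : X -> Z),
    closed Z /\ isomorphism f.

Definition affine_morphism (X Y : spaceWithFunctions k) (f : X -> Y) : Prop :=
  forall y, exists V : set Y,
    [/\ open V, V y, affine V & affine (f @^-1` V)].

(* [good_quotient R pi]: pi is a good quotient (in the sense of Seshadri,     *)
(* Mumford and Newstead) of X by a group whose orbits are the classes of R.   *)
Record good_quotient (X Y : spaceWithFunctions k) (R : X -> X -> Prop)
    (pi : X -> Y) : Prop := GoodQuotient {
  good_quotient_morphism : morphism pi;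
  good_quotient_surj : forall y, exists x, pi x = y;
  good_quotient_invariant : forall x x', R x x' -> pi x = pi x';
  good_quotient_affine : affine_morphism pi;
  good_quotient_functions : forall (V : set Y) (g : X -> k), open V ->
    regular (pi @^-1` V) g ->
    (forall x x', V (pi x) -> R x x' -> g x = g x') ->
    exists2 f : Y -> k, regular V f & forall x, V (pi x) -> g x = f (pi x);
  good_quotient_closed : forall Z : set X, closed Z ->
    (forall x x', R x x' -> Z x -> Z x') -> closed (pi @` Z);
  good_quotient_disjoint : forall Z Z' : set X, closed Z -> closed Z' ->
    (forall x x', R x x' -> Z x -> Z x') ->
    (forall x x', R x x' -> Z' x -> Z' x') ->
    Z `&` Z' = set0 -> (pi @` Z) `&` (pi @` Z') = set0
}.

End GoodQuotient.

Definition GL (k : fieldType) (n : nat) : Type :=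
  set_type [set A : affine_space k n n | A \in unitmx].

Section GLgroup.
Variables (k : fieldType) (n : nat).

HB.instance Definition _ := SpaceWithFunctions.on (GL k n).

Definition GLmx (g : GL k n) : 'M[k]_n := val g.

Lemma GLmx_unit (g : GL k n) : GLmx g \in unitmx.
Proof. exact: set_mem (valP g). Qed.

Definition mkGL (A : 'M[k]_n) (uA : A \in unitmx) : GL k n :=
  @exist _ _ (A : affine_space k n n) (mem_set uA).

Definition GL1 : GL k n := mkGL (unitmx1 k n).

Lemma GLmul_subproof (g h : GL k n) : GLmx g *m GLmx h \in unitmx.
Proof. by rewrite unitmx_mul !GLmx_unit. Qed.

Definition GLmul (g h : GL k n) : GL k n := mkGL (GLmul_subproof g h).

Lemma GLinv_subproof (g : GL k n) : invmx (GLmx g) \in unitmx.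
Proof. by rewrite unitmx_inv GLmx_unit. Qed.

Definition GLinv (g : GL k n) : GL k n := mkGL (GLinv_subproof g).

Let mulgA : associative GLmul.
Proof. by move=> x y z; apply: val_inj; rewrite /= /GLmx /= mulmxA. Qed.
Let mul1g : left_id GL1 GLmul.
Proof. by move=> x; apply: val_inj; rewrite /= /GLmx /= mul1mx. Qed.
Let mulg1 : right_id GL1 GLmul.
Proof. by move=> x; apply: val_inj; rewrite /= /GLmx /= mulmx1. Qed.
Let mulVg : left_inverse GL1 GLinv GLmul.
Proof. by move=> x; apply: val_inj; rewrite /= /GLmx /= mulVmx // GLmx_unit. Qed.
Let mulgV : right_inverse GL1 GLinv GLmul.
Proof. by move=> x; apply: val_inj; rewrite /= /GLmx /= mulmxV // GLmx_unit. Qed.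

HB.instance Definition _ := isGroup.Build (GL k n) mulgA mul1g mulg1 mulVg mulgV.

Lemma GLmxM (g h : GL k n) : GLmx (g * h)%g = GLmx g *m GLmx h.
Proof. by []. Qed.
Lemma GLmxV (g : GL k n) : GLmx g^-1%g = invmx (GLmx g).
Proof. by []. Qed.
Lemma GLmx1 : GLmx (1%g : GL k n) = 1%:M.
Proof. by []. Qed.

End GLgroup.

Section Cosets.
Variables (G : groupType) (H : groupClosed G).

Definition lcoset_rel : rel G := fun g h => (g^-1 * h)%g \in H.

Lemma lcoset_rel_equiv : equiv_class_of lcoset_rel.
Proof.
split=> [g|g h|h g l]; rewrite /lcoset_rel.
- by rewrite mulVg gpred1.
- by apply/idP/idP => /gpredVr; rewrite invgM invgK.
- move=> gh hl; have -> : (g^-1 * l = (g^-1 * h) * (h^-1 * l))%g.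
    by rewrite mulgA mulgK.
  exact: gpredM.
Qed.

Canonical lcoset_equiv := EquivRelPack lcoset_rel_equiv.

(* The set G / H of left cosets g H, with its projection \pi.                 *)
Definition lcosets := {eq_quot lcoset_equiv}.
HB.instance Definition _ := Choice.on lcosets.
HB.instance Definition _ := Quotient.on lcosets.

Lemma pi_lcosetP (g h : G) :
  \pi_lcosets g = \pi_lcosets h <-> (g^-1 * h)%g \in H.
Proof. by split=> [/(eqmodP lcoset_equiv)|gh] //; apply/(eqmodP lcoset_equiv). Qed.

End Cosets.

Section Homogeneous.
Variables (k : fieldType) (n : nat) (H : groupClosed (GL k n)).

Definition homogeneous_space : Type := quotient_topology (lcosets H).
HB.instance Definition _ := SpaceWithFunctions.on homogeneous_space.
HB.instance Definition _ := Quotient.on homogeneous_space.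

(* Left translation; it does not depend on the chosen representative.         *)
Definition translate (g : GL k n) (x : homogeneous_space) : homogeneous_space :=
  \pi_homogeneous_space (g * repr x)%g.

Lemma translate_pi (g h : GL k n) :
  translate g (\pi h) = \pi_homogeneous_space (g * h)%g.
Proof.
apply: (iffRL (pi_lcosetP H _ _)); rewrite invgM -mulgA mulKg.
by apply: (iffLR (pi_lcosetP H _ _)); exact: reprK.
Qed.

End Homogeneous.

Section Triangular.
Variables (k : fieldType) (n : nat).
Implicit Types A B : 'M[k]_n.

Lemma trig_mulmx A B : is_trig_mx A -> is_trig_mx B -> is_trig_mx (A *m B).
Proof.
move=> /is_trig_mxP tA /is_trig_mxP tB; apply/is_trig_mxP => i j ij.
rewrite mxE big1 // => l _; case: (ltnP i l) => [il|li].
  by rewrite tA // mul0r.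
by rewrite tB ?mulr0 // (leq_ltn_trans li).
Qed.

Lemma trig_invmx A : A \in unitmx -> is_trig_mx A -> is_trig_mx (invmx A).
Proof.
move=> uA tA; have Ann i : A i i != 0.
  move: uA; rewrite unitmxE det_trig // unitfE => /prodf_neq0; exact.
move/is_trig_mxP: tA => tA; apply/is_trig_mxP => i j.
have [m] := ubnP (i : nat); elim: m => // m IH in i * => im ij.
have /matrixP/(_ i j) := mulmxV uA; rewrite !mxE (bigD1 i) //= big1 => [|l li].
  rewrite addr0 -val_eqE /= ltn_eqF // => /eqP.
  by rewrite mulf_eq0 (negPf (Ann i)) => /eqP.
case: (ltnP i l) => [il|]; first by rewrite tA // mul0r.
rewrite leq_eqVlt val_eqE (negPf li) /= => l_i.
have lj := ltn_trans l_i ij; have lm : (l < m)%N := leq_trans l_i im.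
by rewrite IH ?mulr0.
Qed.

Lemma diag_mulmx A B : is_diag_mx A -> is_diag_mx B -> is_diag_mx (A *m B).
Proof. by move=> /diag_mxP[d ->] /diag_mxP[e ->]; rewrite mulmx_diag diag_mx_is_diag. Qed.

Lemma diag_invmx A : A \in unitmx -> is_diag_mx A -> is_diag_mx (invmx A).
Proof.
have trE (C : 'M[k]_n) : is_diag_mx C = is_trig_mx C && is_trig_mx C^T.
  apply/is_diag_mxP/andP => [dC|[/is_trig_mxP tC /is_trig_mxP tC'] i j].
    split; apply/is_trig_mxP => i j ij; rewrite ?mxE dC //;
      by apply: contraTneq ij => ->; rewrite ltnn.
  by move=> ij; have : (i != j :> nat) by []; rewrite neq_ltn => /orP[/tC|/tC'] //; rewrite mxE.
move=> uA; rewrite !trE => /andP[tA tA'].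
by rewrite trig_invmx //= trmx_inv trig_invmx // unitmx_tr.
Qed.

End Triangular.

(******************************************************************************)
(* Throughout, P is an invertible matrix, i.e., a basis of k^(n+1) given by   *)
(* its columns.  Every pair (T, B) of a maximal torus T of SL_(n+1) and a     *)
(* Borel subgroup B of GL_(n+1) containing T is (torus P, borel P) for some   *)
(* P; the simple root alpha_(i+1), for i : 'I_n, is the character             *)
(* diag(d_0, ..., d_n) |-> d_i / d_(i+1) in the basis P.  Recall that in a    *)
(* group x ^ y is y^-1 * x * y, so that g ^ P is the matrix of g in this      *)
(* basis.                                                                     *)
(******************************************************************************)
Section TorusBorel.
Variables (k : fieldType) (n : nat) (P : GL k n.+1).

Definition torus : {pred GL k n.+1} :=
  [pred t | is_diag_mx (GLmx (t ^ P)%g) && (\det (GLmx t) == 1)].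

Definition borel : {pred GL k n.+1} :=
  [pred b | is_trig_mx (GLmx (b ^ P)%g)^T].

Let torusM : mulg_closed torus.
Proof.
move=> s t /andP[ds /eqP s1] /andP[dt /eqP t1].
by rewrite inE conjMg !GLmxM diag_mulmx // det_mulmx s1 t1 mul1r /=.
Qed.

Let torus1 : 1%g \in torus.
Proof. by rewrite inE conj1g GLmx1 scalar_mx_is_diag det1 eqxx. Qed.

Let torusV : invg_closed torus.
Proof.
move=> t /andP[dt /eqP t1]; rewrite inE conjVg !GLmxV det_inv t1 invr1 eqxx.
by rewrite diag_invmx ?GLmx_unit.
Qed.

HB.instance Definition _ := isMulClosed.Build _ torus torusM.
HB.instance Definition _ := isMul1Closed.Build _ torus torus1.
HB.instance Definition _ := isInvClosed.Build _ torus torusV.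

Let borelM : mulg_closed borel.
Proof. by move=> a b ta tb; rewrite inE conjMg GLmxM trmx_mul trig_mulmx. Qed.

Let borel1 : 1%g \in borel.
Proof. by rewrite inE conj1g GLmx1 trmx1 scalar_mx_is_trig. Qed.

Let borelV : invg_closed borel.
Proof.
by move=> b tb; rewrite inE conjVg GLmxV trmx_inv trig_invmx ?unitmx_tr ?GLmx_unit.
Qed.

HB.instance Definition _ := isMulClosed.Build _ borel borelM.
HB.instance Definition _ := isMul1Closed.Build _ borel borel1.
HB.instance Definition _ := isInvClosed.Build _ borel borelV.

(* The normaliser N of T in SL_(n+1).                                         *)
Definition normaliser : set (GL k n.+1) :=
  [set nu | \det (GLmx nu) = 1 /\
            forall t, ((t ^ nu)%g \in torus) = (t \in torus)].

(* N / T, as a set of left cosets of T.                                       *)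
Definition weyl_group : Type :=
  set_type [set w : lcosets torus | exists2 nu, normaliser nu & \pi nu = w].

(* GL_n as the subgroup of the matrices diag(g, 1) in the basis P, and the    *)
(* Borel subgroup B_n = B_(n+1) :&: GL_n of GL_n.                             *)
Definition embed_mx (g : 'M[k]_n) : 'M[k]_n.+1 :=
  castmx (addn1 n, addn1 n) (block_mx g 0 0 (1%:M : 'M_1)).

Lemma embed_mxM g h : embed_mx (g *m h) = embed_mx g *m embed_mx h.
Proof.
rewrite /embed_mx; case: _ / (addn1 n) => /=; rewrite !castmx_id.
by rewrite mulmx_block !mulmx0 !mul0mx !addr0 !add0r mulmx1.
Qed.

Lemma embed_mx1 : embed_mx 1%:M = 1%:M.
Proof. by rewrite /embed_mx -scalar_mx_block; case: _ / (addn1 n). Qed.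

Lemma embed_unit (g : GL k n) : embed_mx (GLmx g) \in unitmx.
Proof.
have := congr1 embed_mx (mulmxV (GLmx_unit g)).
by rewrite embed_mxM embed_mx1 => /mulmx1_unit[].
Qed.

Definition embed (g : GL k n) : GL k n.+1 := (mkGL (embed_unit g) ^ P^-1)%g.

Lemma embedM (g h : GL k n) : embed (g * h)%g = (embed g * embed h)%g.
Proof. by rewrite /embed -conjMg; congr (_ ^ _)%g; apply: val_inj; rewrite /= embed_mxM. Qed.

Definition borel_sub : {pred GL k n} := [pred g | embed g \in borel].

Let embed1 : embed 1%g = 1%g.
Proof. by apply: (mulgI (embed 1%g)); rewrite -embedM !mulg1. Qed.

Let embedV (g : GL k n) : embed g^-1%g = (embed g)^-1%g.
Proof. by apply: (mulgI (embed g)); rewrite -embedM !mulgV embed1. Qed.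

Let borel_subM : mulg_closed borel_sub.
Proof. by move=> a b ta tb; rewrite inE embedM gpredM. Qed.

Let borel_sub1 : 1%g \in borel_sub.
Proof. by rewrite inE embed1 gpred1. Qed.

Let borel_subV : invg_closed borel_sub.
Proof. by move=> a ta; rewrite inE embedV gpredVr. Qed.

HB.instance Definition _ := isMulClosed.Build _ borel_sub borel_subM.
HB.instance Definition _ := isMul1Closed.Build _ borel_sub borel_sub1.
HB.instance Definition _ := isInvClosed.Build _ borel_sub borel_subV.

(* The diagonal matrices of trace 0 in the basis P: the Lie algebra of T.     *)
Definition cartan_subalgebra : {vspace 'M[k]_n.+1} :=
  (limg (linfun (fun d : 'rV[k]_n.+1 =>
           GLmx P *m diag_mx d *m GLmx P^-1%g)) :&:
   lker (linfun (fun X : 'M[k]_n.+1 => \tr X : k^o)))%VS.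

(* rho w is the matrix, in the basis b of the Lie algebra of T, of            *)
(* X |-> nu X nu^-1 for any representative nu of w in N.                      *)
Definition weyl_representation (b : n.-tuple 'M[k]_n.+1)
    (rho : weyl_group -> GL k n) : Prop :=
  forall (w : weyl_group) (nu : GL k n.+1),
    normaliser nu -> \pi nu = val w ->
    forall j : 'I_n, GLmx nu *m b`_j *m GLmx nu^-1%g =
                     \sum_(i < n) GLmx (rho w) i j *: b`_i.

End TorusBorel.

(* Characters of the diagonal torus are written additively, as vectors of     *)
(* exponents; the standard pairing identifies the coroots with the roots.     *)
Section Weights.
Variable n : nat.

Definition simple_root (i : 'I_n) : 'rV[int]_n.+1 :=
  delta_mx 0 (widen_ord (leqnSn n) i) - delta_mx 0 (lift ord0 i).

Definition coroot_pairing (chi : 'rV[int]_n.+1) (i : 'I_n) : int :=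
  \sum_(j < n.+1) chi 0 j * simple_root i 0 j.

Definition regular_dominant (chi : 'rV[int]_n.+1) : Prop :=
  forall i, 0 < coroot_pairing chi i.

Definition root_combination (m : 'I_n -> nat) : 'rV[int]_n.+1 :=
  \sum_(i < n) simple_root i *+ m i.

End Weights.

Section GIT.
Variables (k : fieldType) (n : nat) (P : GL k n.+1).
Implicit Types chi : 'rV[int]_n.+1.

Definition character chi (b : GL k n.+1) : k :=
  \prod_(j < n.+1) GLmx (b ^ P)%g j j ^ chi 0 j.

(* H^0(GL_(n+1)/B, L_chi).  The sign convention makes L_chi ample when chi is *)
(* regular dominant for the positive roots of B.                              *)
Definition line_bundle_sections chi : set (GL k n.+1 -> k) :=
  [set f | regular setT f /\
     forall g b, b \in borel P -> f (g * b)%g = character chi b * f g].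

(* The non-vanishing locus of a section of a power of L_chi is automatically  *)
(* affine, L_chi being ample.                                                 *)
Definition semistable chi : set (homogeneous_space (borel P)) :=
  [set x | exists (d : nat) (f : GL k n.+1 -> k),
     [/\ (0 < d)%N, line_bundle_sections (chi *+ d) f,
         forall t g, t \in torus P -> f (t * g)%g = f g
       & forall g, \pi g = x -> f g != 0]].

Definition torus_orbit chi (x y : semistable chi) : Prop :=
  exists2 t, t \in torus P & val y = translate t (val x).

Definition is_GIT_quotient chi (Y : spaceWithFunctions k)
    (pi : semistable chi -> Y) : Prop :=
  good_quotient (@torus_orbit chi) pi.

(* The action of W = N / T on the GIT quotient through the action of N on     *)
(* GL_(n+1)/B; as pi is surjective, this determines act.                      *)
Definition induced_action chi (Y : spaceWithFunctions k)
    (pi : semistable chi -> Y) (act : weyl_group P -> Y -> Y) : Prop :=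
  forall (w : weyl_group P) (nu : GL k n.+1),
    normaliser P nu -> \pi nu = val w ->
    forall x : semistable chi, exists2 y : semistable chi,
      val y = translate nu (val x) & act w (pi x) = pi y.

End GIT.

Arguments semistable {k n} P chi.
Arguments line_bundle_sections {k n} P chi.

(* Main.v *)
Require Import Defs.
From HB Require Import structures.
From mathcomp Require Import all_boot all_order all_algebra.
From mathcomp Require Import all_classical.
From mathcomp Require Import topology_structure initial_topology.
From mathcomp Require Import subtype_topology quotient_topology.
From mathcomp Require Import perm mpoly.

Set Implicit Arguments.
Unset Strict Implicit.
Unset Printing Implicit Defensive.

Import GRing.Theory Num.Theory.

Local Open Scope ring_scope.
Local Open Scope quotient_scope.

(** A point g B of GL_(n+1)/B is a complete flag of k^(n+1): write M for the
    matrix of g in the basis P, so that the flag is spanned by the columns of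
    M and psi, the last row of M^-1, is an equation of its hyperplane.

    In coordinates the hypotheses on chi say that its entries have sum 0 and
    that chi_0 > ... > chi_(n-1) > 0 ([root_combination_pos]).  This sign
    pattern makes the hyperplane alone decide semistability: a flag is
    semistable exactly when no coordinate of psi vanishes.  If none vanishes,
    the invertible matrix N = diag(psi) M does not change when a diagonal
    matrix multiplies M on the left, so monomials in the leading minors of
    A N, for A constant, are invariant sections, and A = N^-1 gives one that
    does not vanish at the flag ([generic_semistable]).  If psi_i = 0, the
    hyperplane contains e_i, and scaling e_i by a parameter that tends to 0
    degenerates the flag inside the flag variety with a positive weight; an
    invariant section must vanish ([nongeneric_section_eq0]).

    The torus acts transitively, with only scalars as stabilisers, on the
    hyperplanes whose equation has nonzero coordinates.  Hence each orbit of
    semistable flags contains exactly one flag whose hyperplane is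
    h = (x_0 + ... + x_n = 0), namely the one spanned by N, and the quotient
    is the variety of flags of the n-dimensional space h.  In a frame D of
    k^(n+1) whose first n vectors span h this is the map [slice], and
    completing flags of h gives a section [slice_section] of it.  A map with
    such a section satisfies the axioms of a good quotient as soon as it is
    affine ([good_quotient_section]), which is checked over the big cells of
    GL_n/B_n ([quotient_map_affine]).  As its fibres are closed orbits, any
    other good quotient is canonically isomorphic to it
    ([good_quotient_unique]).

    An element nu of N is monomial in the basis P ([normaliser_monomial]), and
    multiplying M by it multiplies N by the underlying permutation matrix
    ([balanced_monomial]).  So W acts on flags of h by permuting coordinates.
    But h is also the Cartan subalgebra, a vector of h being the diagonal of a
    matrix of trace 0, and W permutes diagonals in the same way by conjugation
    ([conj_toral]): taking for D the frame of a basis of the Cartan subalgebra,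
    both actions are given by the same n x n matrix ([slice_monomial]). *)

(** * Regular functions and matrices of regular functions *)

Section RegularFunctions.
Local Open Scope classical_set_scope.
Variables (k : fieldType) (X : spaceWithFunctions k).
Implicit Types (U V : set X) (f g : X -> k).

(** The locality axiom with a single chart; it lets a regular function be
    replaced by a more convenient formula on the open set of interest. *)
Lemma eq_regular U f g : open U -> (forall x, U x -> f x = g x) ->
  regular U f -> regular U g.
Proof.
move=> oU fg rf; apply: regular_local => // x Ux.
by exists U, f; split=> // y Uy _; rewrite fg.
Qed.

Lemma sub_regular_on U V f : open V -> V `<=` U -> open U ->
  regular U f -> regular V f.
Proof.
move=> oV VU oU rf; apply: regular_local => // x Vx.
by exists U, f; split=> //; exact: VU.
Qed.

Lemma regularZ U c f : open U -> regular U f -> regular U (fun x => c * f x).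
Proof. by move=> oU rf; apply: regularM => //; exact: regular_cst. Qed.

Lemma regularN U f : open U -> regular U f -> regular U (fun x => - f x).
Proof.
move=> oU rf; apply: eq_regular (regularZ (-1) oU rf) => // x _.
by rewrite mulN1r.
Qed.

Lemma regular_sum U (I : Type) (r : seq I) (p : pred I) (F : I -> X -> k) :
  open U -> (forall i, p i -> regular U (F i)) ->
  regular U (fun x => \sum_(i <- r | p i) F i x).
Proof.
move=> oU rF; elim: r => [|i r IH].
  by apply: eq_regular (regular_cst _ 0 oU) => // x _; rewrite big_nil.
case pi: (p i).
  apply: eq_regular (regularD _ _ _ oU (rF i pi) IH) => // x _.
  by rewrite big_cons pi.
by apply: eq_regular IH => // x _; rewrite big_cons pi.
Qed.

Lemma regular_prod U (I : Type) (r : seq I) (p : pred I) (F : I -> X -> k) :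
  open U -> (forall i, p i -> regular U (F i)) ->
  regular U (fun x => \prod_(i <- r | p i) F i x).
Proof.
move=> oU rF; elim: r => [|i r IH].
  by apply: eq_regular (regular_cst _ 1 oU) => // x _; rewrite big_nil.
case pi: (p i).
  apply: eq_regular (regularM _ _ _ oU (rF i pi) IH) => // x _.
  by rewrite big_cons pi.
by apply: eq_regular IH => // x _; rewrite big_cons pi.
Qed.

Lemma regularX U f e : open U -> regular U f -> regular U (fun x => f x ^+ e).
Proof.
move=> oU rf; elim: e => [|e IH].
  by apply: eq_regular (regular_cst _ 1 oU) => // x _; rewrite expr0.
by apply: eq_regular (regularM _ _ _ oU rf IH) => // x _; rewrite exprS.
Qed.

Lemma regular_inv U f : open U -> (forall x, U x -> f x != 0) ->
  regular U f -> regular U (fun x => (f x)^-1).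
Proof.
move=> oU f0 rf; have [_] := regularV _ _ oU rf.
suff -> : U `&` [set x | f x != 0] = U by [].
by apply/seteqP; split=> [x []|x Ux] //; split=> //; exact: f0.
Qed.

Lemma open_nonzero U f : open U -> regular U f ->
  open (U `&` [set x | f x != 0]).
Proof. by move=> oU rf; case: (regularV _ _ oU rf). Qed.

Definition regular_mx U p q (F : X -> 'M[k]_(p, q)) : Prop :=
  forall i j, regular U (fun x => F x i j).

Lemma regular_mx_cst U p q (A : 'M[k]_(p, q)) :
  open U -> regular_mx U (fun=> A).
Proof. by move=> oU i j; exact: regular_cst. Qed.

Lemma regular_mxM U p q r (F : X -> 'M[k]_(p, q)) (G : X -> 'M[k]_(q, r)) :
  open U -> regular_mx U F -> regular_mx U G ->
  regular_mx U (fun x => F x *m G x).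
Proof.
move=> oU rF rG i j.
apply: (@eq_regular _ (fun x => \sum_l F x i l * G x l j)) => // [x _|].
  by rewrite mxE.
by apply: regular_sum => // l _; apply: regularM.
Qed.

Lemma regular_det U p (F : X -> 'M[k]_p) :
  open U -> regular_mx U F -> regular U (fun x => \det (F x)).
Proof.
move=> oU rF; rewrite /determinant.
apply: regular_sum => // s _; apply: regularM => //; first exact: regular_cst.
by apply: regular_prod => // i _; exact: rF.
Qed.

(** By Cramer's rule the entries of the inverse are cofactors divided by the
    determinant. *)
Lemma regular_mx_inv U p (F : X -> 'M[k]_p) :
  open U -> (forall x, U x -> F x \in unitmx) -> regular_mx U F ->
  regular_mx U (fun x => invmx (F x)).
Proof.
move=> oU uF rF i j.
apply: (@eq_regular _ (fun x => (\det (F x))^-1 * cofactor (F x) j i)) => //.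
  by move=> x Ux; rewrite /invmx uF // !mxE.
apply: regularM => //.
  apply: regular_inv => // [x /uF|]; first by rewrite unitmxE unitfE.
  exact: regular_det.
apply: regularZ => //; apply: regular_det => // a b.
apply: (@eq_regular _ (fun x => F x (lift j a) (lift i b))) => // x _.
by rewrite !mxE.
Qed.

End RegularFunctions.

(** * Maps that are morphisms on an open set *)

Section MorphismOn.
Local Open Scope classical_set_scope.
Variable k : fieldType.
Implicit Types X Y Z : spaceWithFunctions k.

(** Maps given by formulas with denominators are total functions with junk
    values; this notion lets them be composed and restricted without passing to
    subspaces, and the subspaces and quotients of interest have universal
    properties for it. *)
Definition morphism_on X Y (U : set X) (f : X -> Y) : Prop :=
  forall V, open V -> open (U `&` f @^-1` V) /\
    forall h, regular V h -> regular (U `&` f @^-1` V) (h \o f).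

Lemma morphism_onT X Y (f : X -> Y) : morphism_on setT f <-> morphism f.
Proof.
split=> [mf|[cf rf] V oV].
  by split=> [|V h oV rh]; first (apply/continuousP => V oV);
     have [] := mf V oV; rewrite setTI // => _; apply.
rewrite setTI; split; first by move/continuousP: cf; apply.
by move=> h rh; apply: rf.
Qed.

Lemma morphism_on_regular X Y (U : set X) (f : X -> Y) V h :
  morphism_on U f -> open V -> regular V h ->
  regular (U `&` f @^-1` V) (h \o f).
Proof. by move=> mf oV; apply: (mf V oV).2. Qed.

Lemma morphism_on_comp X Y Z (U : set X) (V : set Y) (f : X -> Y) (g : Y -> Z) :
  morphism_on U f -> morphism_on V g ->
  morphism_on (U `&` f @^-1` V) (g \o f).
Proof.
move=> mf mg W oW; have [oVW rVW] := mg W oW.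
have -> : U `&` f @^-1` V `&` (g \o f) @^-1` W =
          U `&` f @^-1` (V `&` g @^-1` W) by rewrite -setIA.
have [oU rU] := mf _ oVW; split=> // h /rVW; exact: rU.
Qed.

Lemma sub_morphism_on X Y (U V : set X) (f : X -> Y) :
  open V -> V `<=` U -> morphism_on U f -> morphism_on V f.
Proof.
move=> oV VU mf W oW; have [oUW rUW] := mf W oW.
have E : V `&` f @^-1` W = V `&` (U `&` f @^-1` W).
  by rewrite setIA (setIidl VU).
have o' : open (V `&` f @^-1` W) by rewrite E; exact: openI.
split=> // h /rUW rh; apply: sub_regular_on rh => //.
by rewrite E; exact: subIsetr.
Qed.

Lemma eq_morphism_on X Y (U : set X) (f g : X -> Y) :
  (forall x, U x -> f x = g x) -> morphism_on U f -> morphism_on U g.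
Proof.
move=> fg mf W oW; have [oUW rUW] := mf W oW.
have E : U `&` g @^-1` W = U `&` f @^-1` W.
  by apply/seteqP; split=> x [Ux /= Wx]; split=> //=; rewrite ?fg // -fg.
rewrite E; split=> // h /rUW; apply: eq_regular => // x [Ux _] /=.
by rewrite fg.
Qed.

(** A map to affine space is a morphism as soon as its coordinates are regular:
    polynomials in the coordinates are then regular, and these control both the
    open sets and the regular functions of affine space. *)
Lemma morphism_on_regular_mx X (U : set X) p q (F : X -> affine_space k p q) :
  open U -> regular_mx U F -> morphism_on U F.
Proof.
move=> oU rF.
have rP (s : mpoly.mpoly (p * q) k) : regular U (fun x => poly_eval s (F x)).
  rewrite /poly_eval /mpoly.meval /mpoly.mmap.
  apply: regular_sum => // m _; apply: regularM => //.
    exact: regular_cst.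
  rewrite /mpoly.mmap1; apply: regular_prod => // i _.
  apply: regularX => //.
  case/mxvec_indexP: i => i j.
  by apply: (eq_regular oU _ (rF i j)) => x _; rewrite mxvecE.
have oV V : open V -> open (U `&` F @^-1` V).
  move=> [S ->].
  have -> : U `&` F @^-1` [set a | exists2 s, S s & poly_eval s a != 0] =
      \bigcup_(s in S) (U `&` [set x | poly_eval s (F x) != 0]).
    apply/seteqP; split=> x /=.
      by move=> [Ux [s Ss sx]]; exists s.
    by move=> [s Ss [Ux sx]]; split=> //; exists s.
  by apply: bigcup_open => s _; apply: open_nonzero.
move=> V oVV; split; first exact: oV.
move=> h rh; apply: regular_local; first exact: oV.
move=> x [Ux Vx]; have [s [t [tx hE]]] := rh _ Vx.
have oUt := open_nonzero oU (rP t).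
exists (U `&` [set x | poly_eval t (F x) != 0]),
       (fun x => poly_eval s (F x) * (poly_eval t (F x))^-1); split=> //.
  have rP' r : regular (U `&` [set x | poly_eval t (F x) != 0])
      (fun x => poly_eval r (F x)).
    by apply: sub_regular_on (rP r) => //; exact: subIsetl.
  by apply: regularM => //; apply: regular_inv => // y [].
by move=> y [Uy Vy] [_ ty] /=; rewrite hE.
Qed.

Lemma regular_coord p q (i : 'I_p) (j : 'I_q) :
  regular setT (fun A : affine_space k p q => A i j).
Proof.
move=> A _; exists (mpoly.mpolyX _ (mpoly.mnm1 (mxvec_index i j))), (mpoly.mpolyC _ 1).
rewrite /poly_eval mpoly.mevalC oner_eq0; split=> // B _ _.
by rewrite mpoly.mevalXU mpoly.mevalC divr1 mxvecE.
Qed.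

Lemma regular_mx_comp X (U : set X) p q (F : X -> affine_space k p q) :
  morphism_on U F -> regular_mx U F.
Proof.
move=> mF i j; have := morphism_on_regular mF openT (regular_coord i j).
by rewrite preimage_setT setIT.
Qed.

Section Subspace.
Variables (X Y : spaceWithFunctions k) (S : set Y).

Lemma morphism_on_val : morphism_on setT (val : S -> Y).
Proof.
apply/morphism_onT; split; first exact: initial_continuous.
move=> V h oV rh; change (sub_regular (val @^-1` V) (h \o (val : S -> Y))).
by move=> x Vx; exists V, h.
Qed.

Lemma morphism_on_sub (U : set X) (f : X -> S) :
  morphism_on U (val \o f) -> morphism_on U f.
Proof.
move=> mf.
have oU V : open V -> open (U `&` f @^-1` V).
  by move=> [V' oV' <-]; have [] := mf V' oV'.
move=> V oV; split; first exact: oU.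
move=> h rh; apply: regular_local; first exact: oU.
move=> x [Ux Vx]; have [V' [g [oV' Vx' rg hg]]] := rh _ Vx.
have [oUV' rUV'] := mf V' oV'.
exists (U `&` (val \o f) @^-1` V'), (g \o (val \o f)); split=> //.
  exact: rUV'.
by move=> y [Uy Vy] [_ V'y] /=; rewrite hg.
Qed.

End Subspace.

Section Quotient.
Variables (X Y : spaceWithFunctions k) (Q0 : quotType X).
Local Notation Q := (quotient_topology Q0).

Lemma morphism_on_pi : morphism_on setT (\pi_Q : X -> Q).
Proof. by apply/morphism_onT; split=> [|V h oV rh] //; exact: pi_continuous. Qed.

Lemma morphism_on_quotient (U : set Q) (f : Q -> Y) :
  morphism_on (\pi_Q @^-1` U) (f \o \pi_Q) -> morphism_on U f.
Proof. by move=> mf V oV; have [oV' rV'] := mf V oV; split. Qed.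

End Quotient.

Lemma morphism_comp X Y Z (f : X -> Y) (g : Y -> Z) :
  morphism f -> morphism g -> morphism (g \o f).
Proof.
move=> /morphism_onT mf /morphism_onT mg; apply/morphism_onT.
by have := morphism_on_comp mf mg; rewrite setIT.
Qed.

End MorphismOn.

(** * Leading minors and the LU factorisation *)

Section LU.
Variables (k : fieldType) (n : nat).
Implicit Types A U L : 'M[k]_n.

(** Padding the leading r x r block with an identity keeps all the blocks in one
    matrix type; its determinant is the leading minor of order r. *)
Definition corner (r : nat) A : 'M[k]_n :=
  \matrix_(i, j) if (i < r)%N && (j < r)%N then A i j else (i == j)%:R.

Definition upper_trig U : Prop := forall i j : 'I_n, (j < i)%N -> U i j = 0.

Definition lower_unitrig L : Prop :=
  forall i j : 'I_n, (i <= j)%N -> L i j = (i == j)%:R.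

Lemma upper_trigP U : reflect (upper_trig U) (is_trig_mx U^T).
Proof.
apply: (iffP is_trig_mxP) => H i j ij; first by rewrite -(H j i ij) mxE.
by rewrite mxE H.
Qed.

Lemma det_upper_trig U : upper_trig U -> \det U = \prod_i U i i.
Proof.
move=> /upper_trigP tU; rewrite -det_tr det_trig //.
by apply: eq_bigr => i _; rewrite mxE.
Qed.

Lemma upper_trigM U V : upper_trig U -> upper_trig V -> upper_trig (U *m V).
Proof.
move=> /upper_trigP tU /upper_trigP tV; apply/upper_trigP.
by rewrite trmx_mul trig_mulmx.
Qed.

Lemma upper_trigV U : U \in unitmx -> upper_trig U -> upper_trig (invmx U).
Proof.
move=> uU /upper_trigP tU; apply/upper_trigP.
by rewrite trmx_inv trig_invmx ?unitmx_tr.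
Qed.

Lemma upper_trig_diag_neq0 U : U \in unitmx -> upper_trig U ->
  forall i, U i i != 0.
Proof.
move=> uU tU i; move: uU; rewrite unitmxE unitfE det_upper_trig // => /prodf_neq0.
exact.
Qed.

Lemma lower_unitrigP L : lower_unitrig L <->
  is_trig_mx L /\ forall i, L i i = 1.
Proof.
split=> [uL|[/is_trig_mxP tL L1] i j].
  split=> [|i]; last by rewrite uL // eqxx.
  apply/is_trig_mxP => i j ij; rewrite uL; last exact: ltnW.
  by rewrite -val_eqE ltn_eqF.
rewrite leq_eqVlt => /orP[/eqP/val_inj->|ij]; first by rewrite L1 eqxx.
by rewrite tL // -val_eqE ltn_eqF.
Qed.

Lemma det_lower_unitrig L : lower_unitrig L -> \det L = 1.
Proof.
by move=> /lower_unitrigP[tL L1]; rewrite det_trig // big1.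
Qed.

(** The first r columns of A U involve only the first r columns of A; hence
    leading minors of A are semi-invariant under the upper triangular group. *)
Lemma corner_mul_upper r A U : upper_trig U ->
  corner r (A *m U) = corner r A *m corner r U.
Proof.
move=> tU; apply/matrixP => i j; rewrite !mxE.
case: (ltnP i r) => [ir|ri] /=; last first.
  rewrite (bigD1 i) //= big1 => [|l li].
    by rewrite !mxE eqxx ltnNge ri /= mul1r addr0.
  by rewrite !mxE ltnNge ri /= eq_sym (negPf li) mul0r.
case: (ltnP j r) => [jr|rj].
  apply: eq_bigr => l _; rewrite !mxE ir jr andbT /=.
  case: (ltnP l r) => // rl.
  by rewrite tU ?mulr0 ?(leq_trans jr) // -!val_eqE /= (ltn_eqF (leq_trans ir rl)) mul0r.
rewrite (bigD1 j) //= big1 => [|l lj].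
  by rewrite !mxE eqxx (ltnNge j) rj !andbF mulr1 addr0.
by rewrite !mxE (ltnNge j) rj !andbF (negPf lj) mulr0.
Qed.

Lemma det_corner_upper r U : upper_trig U ->
  \det (corner r U) = \prod_(i < n | (i < r)%N) U i i.
Proof.
move=> tU; rewrite det_upper_trig => [|i j ji]; last first.
  by rewrite mxE tU // -val_eqE (gtn_eqF ji) if_same.
by rewrite [RHS]big_mkcond; apply: eq_bigr => i _; rewrite mxE andbb eqxx.
Qed.

Definition lu_minors A : k := \prod_(j < n) \det (corner j.+1 A).

(** The column j is the last column of the inverse of the leading block of order
    j + 1, so that multiplying A by it kills the entries above the diagonal and
    makes the diagonal entry 1: this is a closed formula, visibly regular in A,
    for the upper triangular factor that turns A into a lower unitriangular
    matrix. *)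
Definition lu_right A : 'M[k]_n :=
  \matrix_(l, j) if (l <= j)%N then invmx (corner j.+1 A) l j else 0.

Definition lu_left A : 'M[k]_n := A *m lu_right A.

Lemma lu_right_upper A : upper_trig (lu_right A).
Proof. by move=> i j ji; rewrite mxE leqNgt ji. Qed.

Lemma lu_left_unitrig A : lu_minors A != 0 -> lower_unitrig (lu_left A).
Proof.
move=> /prodf_neq0 mA i j ij.
have uC : corner j.+1 A \in unitmx by rewrite unitmxE unitfE mA.
have /matrixP/(_ i j) := mulmxV uC; rewrite [RHS]mxE => <-.
rewrite !mxE; apply: eq_bigr => l _; rewrite !mxE !ltnS ij /=.
case: leqP => // jl; rewrite mulr0 -val_eqE /= ltn_eqF ?mul0r //.
exact: leq_ltn_trans jl.
Qed.

Lemma lu_right_unit A : lu_minors A != 0 -> lu_right A \in unitmx.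
Proof.
move=> mA; have := det_lower_unitrig (lu_left_unitrig mA).
rewrite det_mulmx unitmxE unitfE => D; apply/eqP => R0.
by move: D; rewrite R0 mulr0 => /eqP; rewrite eq_sym oner_eq0.
Qed.

Lemma lu_minorsM A U : upper_trig U -> U \in unitmx ->
  (lu_minors (A *m U) != 0) = (lu_minors A != 0).
Proof.
move=> tU uU; have U0 := upper_trig_diag_neq0 uU tU.
rewrite /lu_minors; apply/prodf_neq0/prodf_neq0 => H j _; move: (H j isT);
  rewrite corner_mul_upper // det_mulmx mulf_eq0 negb_or.
  by case/andP.
by move=> ->; rewrite det_corner_upper //; apply/prodf_neq0 => i _.
Qed.

(** Uniqueness of the LU factorisation: U is both lower unitriangular and upper
    triangular, thus the identity. *)
Lemma unitrig_upper_eq L1 L2 U : lower_unitrig L1 -> lower_unitrig L2 ->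
  upper_trig U -> L1 = L2 *m U -> L1 = L2.
Proof.
move=> /lower_unitrigP[t1 d1] uL2 tU E.
have [t2 d2] := (lower_unitrigP L2).1 uL2.
have u2 : L2 \in unitmx by rewrite unitmxE det_lower_unitrig ?unitr1.
have EU : U = invmx L2 *m L1 by rewrite E mulKmx.
have /is_trig_mxP tU' : is_trig_mx U by rewrite EU trig_mulmx ?trig_invmx.
suff U1 : U = 1%:M by rewrite E U1 mulmx1.
apply/matrixP => i j; rewrite mxE; have [<-|ij] := eqVneq i j; last first.
  by move: ij; rewrite -val_eqE neq_ltn => /orP[/tU'|/tU].
have := d1 i; rewrite E mxE (bigD1 i) //= d2 mul1r big1 ?addr0 // => l li.
by move: li; rewrite -val_eqE neq_ltn => /orP[/tU'|/tU] ->; rewrite mulr0.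
Qed.

Lemma lu_left_mul_upper A U : upper_trig U -> U \in unitmx ->
  lu_minors A != 0 -> lu_left (A *m U) = lu_left A.
Proof.
move=> tU uU mA; have mAU : lu_minors (A *m U) != 0 by rewrite lu_minorsM.
apply: (@unitrig_upper_eq _ _ (invmx (lu_right A) *m U *m lu_right (A *m U))).
- exact: lu_left_unitrig.
- exact: lu_left_unitrig.
- apply: upper_trigM (lu_right_upper _); apply: upper_trigM => //.
  by apply: upper_trigV (lu_right_upper _); exact: lu_right_unit.
- by rewrite /lu_left !mulmxA mulmxK ?lu_right_unit.
Qed.

Lemma corner_unitrig r L : lower_unitrig L -> lower_unitrig (corner r L).
Proof. by move=> uL i j ij; rewrite mxE uL // if_same. Qed.

Lemma lu_minors_unitrig L : lower_unitrig L -> lu_minors L != 0.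
Proof.
move=> uL; apply/prodf_neq0 => j _.
by rewrite det_lower_unitrig ?oner_eq0 //; exact: corner_unitrig.
Qed.

Lemma lu_left_id L : lower_unitrig L -> lu_left L = L.
Proof.
move=> uL; apply: (@unitrig_upper_eq _ _ (lu_right L)) => //.
  by apply: lu_left_unitrig; exact: lu_minors_unitrig.
exact: lu_right_upper.
Qed.

End LU.

Section LURegular.
Local Open Scope classical_set_scope.
Variables (k : fieldType) (X : spaceWithFunctions k) (n : nat).
Variables (U : set X) (F : X -> 'M[k]_n).
Hypotheses (oU : open U) (rF : regular_mx U F).

Lemma regular_corner r : regular_mx U (fun x => corner r (F x)).
Proof.
move=> i j; case ij: ((i < r)%N && (j < r)%N).
  by apply: eq_regular (rF i j) => // x _; rewrite mxE ij.
by apply: eq_regular (regular_cst _ _ oU) => // x _; rewrite mxE ij.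
Qed.

Lemma regular_lu_minors : regular U (fun x => lu_minors (F x)).
Proof.
by apply: regular_prod => // j _; apply: regular_det => //; exact: regular_corner.
Qed.

Lemma regular_lu_left : (forall x, U x -> lu_minors (F x) != 0) ->
  regular_mx U (fun x => lu_left (F x)).
Proof.
move=> mF; apply: regular_mxM => // i j; case ij: (i <= j)%N.
  apply: (@eq_regular _ _ _ (fun x => invmx (corner j.+1 (F x)) i j)) => //.
    by move=> x _; rewrite mxE ij.
  apply: regular_mx_inv => // [x /mF/prodf_neq0|]; last exact: regular_corner.
  by rewrite unitmxE unitfE; apply.
by apply: eq_regular (regular_cst _ 0 oU) => // x _; rewrite mxE ij.
Qed.

End LURegular.

(** * Block matrices with a trivial last row *)

Section UpperLeft.
Variables (k : fieldType) (n : nat).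
Implicit Types (A B : 'M[k]_n.+1) (g : 'M[k]_n).

Definition upper_left A : 'M[k]_n :=
  \matrix_(i, j) A (lift ord_max i) (lift ord_max j).

Definition last_row_unit A : Prop :=
  forall j, A ord_max j = (j == ord_max)%:R.

Lemma det_upper_left A : last_row_unit A -> \det A = \det (upper_left A).
Proof.
move=> lA; rewrite (expand_det_row _ ord_max) (bigD1 ord_max) //= big1.
  rewrite lA eqxx mul1r addr0 /cofactor /= -signr_odd oddD addbb mul1r.
  by congr (\det _); apply/matrixP => i j; rewrite !mxE.
by move=> j /negPf jm; rewrite lA jm mul0r.
Qed.

Lemma upper_leftM A B : (forall j, B ord_max (lift ord_max j) = 0) ->
  upper_left (A *m B) = upper_left A *m upper_left B.
Proof.
move=> B0; apply/matrixP => i j; rewrite !mxE (bigD1_ord ord_max) //= B0 mulr0.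
by rewrite add0r; apply: eq_bigr => l _; rewrite !mxE.
Qed.

Lemma upper_left_trig A : upper_trig A -> upper_trig (upper_left A).
Proof.
move=> tA i j ij; rewrite mxE; apply: tA.
by rewrite !lift_max.
Qed.

Let cast_lift l : cast_ord (esym (addn1 n)) (lift ord_max l) = lshift 1 l.
Proof. by apply: val_inj; exact: lift_max. Qed.

Let cast_max : cast_ord (esym (addn1 n)) ord_max = rshift n ord0.
Proof. by apply: val_inj; rewrite /= addn0. Qed.

Lemma embed_mxE g (i j : 'I_n) :
  embed_mx g (lift ord_max i) (lift ord_max j) = g i j.
Proof. by rewrite /embed_mx castmxE !cast_lift block_mxEul. Qed.

Lemma embed_mx_last_row g : last_row_unit (embed_mx g).
Proof.
move=> j; rewrite /embed_mx castmxE cast_max.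
case: (unliftP ord_max j) => [j' ->|->].
  by rewrite cast_lift block_mxEdl mxE eq_sym (negPf (neq_lift _ _)).
by rewrite cast_max block_mxEdr mxE !eqxx.
Qed.

Lemma embed_mx_last_col g i : embed_mx g i ord_max = (i == ord_max)%:R.
Proof.
rewrite /embed_mx castmxE cast_max.
case: (unliftP ord_max i) => [i' ->|->].
  by rewrite cast_lift block_mxEur mxE eq_sym (negPf (neq_lift _ _)).
by rewrite cast_max block_mxEdr mxE !eqxx.
Qed.

Lemma upper_left_embed g : upper_left (embed_mx g) = g.
Proof. by apply/matrixP => i j; rewrite mxE embed_mxE. Qed.

Lemma embed_mx_upper g : upper_trig g -> upper_trig (embed_mx g).
Proof.
move=> tg i j; case: (unliftP ord_max i) => [i'|] ->.
  case: (unliftP ord_max j) => [j'|] -> ji.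
    by rewrite embed_mxE tg //; rewrite !lift_max in ji.
  by move: ji; rewrite lift_max ltnNge ltnW //; exact: ltn_ord.
by move=> ji; rewrite embed_mx_last_row -val_eqE ltn_eqF.
Qed.

Lemma upper_trig_last_row A :
  last_row_unit A -> upper_left A = 1%:M -> upper_trig A.
Proof.
move=> lA A1 i j; case: (unliftP ord_max i) => [i'|] -> ji; last first.
  by rewrite lA -val_eqE ltn_eqF.
case: (unliftP ord_max j) ji => [j'|] -> ji.
  have /matrixP/(_ i' j') := A1; rewrite !mxE => ->.
  by rewrite -val_eqE gtn_eqF //; rewrite !lift_max in ji.
by move: ji; rewrite lift_max ltnNge ltnW //; exact: ltn_ord.
Qed.

Lemma lower_unitrig_embed g : lower_unitrig g -> lower_unitrig (embed_mx g).
Proof.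
move=> ug i j; case: (unliftP ord_max i) => [i'|] -> ij; last first.
  by rewrite embed_mx_last_row eq_sym.
case: (unliftP ord_max j) ij => [j'|] -> ij; last exact: embed_mx_last_col.
by rewrite embed_mxE ug ?(inj_eq lift_inj) //; rewrite !lift_max in ij.
Qed.

Lemma lower_unitrig_upper_left A : lower_unitrig A -> lower_unitrig (upper_left A).
Proof.
by move=> uA i j ij; rewrite mxE uA ?(inj_eq lift_inj) // !lift_max.
Qed.

Lemma upper_leftK A : lower_unitrig A -> last_row_unit A ->
  embed_mx (upper_left A) = A.
Proof.
move=> uA lA; apply/matrixP => i j.
case: (unliftP ord_max i) => [i'|] ->; last by rewrite embed_mx_last_row lA.
case: (unliftP ord_max j) => [j'|] ->; first by rewrite embed_mxE mxE.
by rewrite embed_mx_last_col uA // -ltnS; exact: ltn_ord.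
Qed.

End UpperLeft.

(** * The hyperplane of a flag and its balanced frame *)

Lemma GLmx_inj (k : fieldType) n : injective (@GLmx k n).
Proof. exact: val_inj. Qed.

Definition GL_of_mx (k : fieldType) n (M : 'M[k]_n) : GL k n :=
  if (M \in unitmx) =P true is ReflectT uM then mkGL uM else 1%g.

Lemma GL_of_mxK (k : fieldType) n (M : 'M[k]_n) :
  M \in unitmx -> GLmx (GL_of_mx M) = M.
Proof. by move=> uM; rewrite /GL_of_mx; case: eqP. Qed.

Section Coordinates.
Variables (k : fieldType) (n : nat) (P : GL k n.+1).
Implicit Types (g h b : GL k n.+1) (M : 'M[k]_n.+1).

Definition basis_mx g : 'M[k]_n.+1 := GLmx (g ^ P)%g.

Lemma basis_mxM g h : basis_mx (g * h)%g = basis_mx g *m basis_mx h.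
Proof. by rewrite /basis_mx conjMg. Qed.

Lemma basis_mx_unit g : basis_mx g \in unitmx.
Proof. exact: GLmx_unit. Qed.

Lemma basis_mxV g : basis_mx g^-1%g = invmx (basis_mx g).
Proof. by rewrite /basis_mx conjVg. Qed.

Lemma basis_mxE g : basis_mx g = invmx (GLmx P) *m (GLmx g *m GLmx P).
Proof. by rewrite /basis_mx conjgE. Qed.

Lemma GLmx_basis_mx g :
  GLmx g = GLmx P *m (basis_mx g *m invmx (GLmx P)).
Proof.
by rewrite basis_mxE !mulmxA mulmxV ?GLmx_unit // mul1mx mulmxK // GLmx_unit.
Qed.

Lemma det_basis_mx g : \det (basis_mx g) = \det (GLmx g).
Proof.
rewrite basis_mxE !det_mulmx mulrCA det_inv mulVf ?mulr1 //.
by rewrite -unitfE -unitmxE GLmx_unit.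
Qed.

(** Locked, as otherwise unification sees through it as a product and the
    multiplicativity of [basis_mx] would apply to it. *)
Definition of_basis_mx M : GL k n.+1 := locked (GL_of_mx M ^ P^-1)%g.

Lemma of_basis_mxK M : M \in unitmx -> basis_mx (of_basis_mx M) = M.
Proof. by move=> uM; rewrite /basis_mx /of_basis_mx -lock conjgKV GL_of_mxK. Qed.

Lemma diag_torus (d : 'rV[k]_n.+1) :
  \prod_j d 0 j = 1 -> of_basis_mx (diag_mx d) \in torus P.
Proof.
move=> d1; have ud : diag_mx d \in unitmx by rewrite unitmxE det_diag d1 unitr1.
apply/andP; split; first by rewrite -/(basis_mx _) of_basis_mxK ?diag_mx_is_diag.
by rewrite -det_basis_mx of_basis_mxK // det_diag d1.
Qed.

Lemma basis_mx_inj g h : basis_mx g = basis_mx h -> g = h.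
Proof. by move=> E; apply: (@conjg_inj _ P); apply: val_inj. Qed.

Lemma borelP b : reflect (upper_trig (basis_mx b)) (b \in borel P).
Proof. exact: upper_trigP. Qed.

Lemma borel_diag_neq0 b i : b \in borel P -> basis_mx b i i != 0.
Proof.
by move=> /borelP tb; exact: upper_trig_diag_neq0 (basis_mx_unit b) tb i.
Qed.

Lemma basis_mx_diag_neq0 h d j : basis_mx h = diag_mx d -> d 0 j != 0.
Proof.
move=> hd; have := basis_mx_unit h; rewrite hd unitmxE det_diag unitfE.
by move/prodf_neq0; apply.
Qed.

Lemma pi_borelP g h : \pi_(homogeneous_space (borel P)) g = \pi h <->
  upper_trig (basis_mx (g^-1 * h)%g).
Proof.
split=> [/(iffLR (pi_lcosetP (borel P) _ _))/borelP //|/borelP gh].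
exact: (iffRL (pi_lcosetP (borel P) _ _)).
Qed.

Lemma regular_GLmx : regular_mx setT (fun g : GL k n.+1 => GLmx g).
Proof. exact: regular_mx_comp (@morphism_on_val _ _ _). Qed.

Lemma regular_basis_mx : regular_mx setT basis_mx.
Proof.
have oT : open (setT : set (GL k n.+1)) by exact: openT.
have rP (A : 'M[k]_n.+1) : regular_mx (setT : set (GL k n.+1)) (fun=> A).
  exact: regular_mx_cst.
have := regular_mxM oT (rP (invmx (GLmx P)))
  (regular_mxM oT regular_GLmx (rP (GLmx P))).
move=> H i j; apply: eq_regular (H i j) => // g _; by rewrite basis_mxE.
Qed.

(** This row vector kills the first n columns of the matrix of g: it is the
    equation, up to a scalar, of the hyperplane of the flag g B. *)
Definition hyperplane g : 'rV[k]_n.+1 := row ord_max (invmx (basis_mx g)).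

(** The hyperplane of the flag contains no coordinate vector. *)
Definition generic g : Prop := forall j, hyperplane g 0 j != 0.

(** When g is generic, the diagonal matrix moves the hyperplane of its flag to
    the one where the sum of the coordinates is 0; this is the only such
    diagonal matrix up to scalars, whence the invariance below. *)
Definition balanced g : 'M[k]_n.+1 := diag_mx (hyperplane g) *m basis_mx g.

Definition last_diag b := basis_mx b ord_max ord_max.

Lemma hyperplane_borel g b : b \in borel P ->
  hyperplane (g * b)%g = (last_diag b)^-1 *: hyperplane g.
Proof.
move=> bB; have b0 := borel_diag_neq0 ord_max bB; move/borelP: bB => tb.
apply/rowP => j; rewrite !mxE -basis_mxV invgM basis_mxM mxE.
rewrite (bigD1_ord ord_max) //= big1 ?addr0 => [|l _]; last first.
  rewrite basis_mxV (upper_trigV _ tb) ?basis_mx_unit ?mul0r //.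
  by rewrite lift_max /= ltn_ord.
rewrite basis_mxV; congr (_ * _); last by rewrite basis_mxV.
apply: (mulIf b0); rewrite mulVf //.
have /matrixP/(_ ord_max ord_max) := mulVmx (basis_mx_unit b).
rewrite [RHS]mxE eqxx mulr1n mxE => <-; rewrite (bigD1_ord ord_max) //= big1 ?addr0 // => l _.
rewrite (upper_trigV _ tb) ?basis_mx_unit ?mul0r //.
by rewrite lift_max /= ltn_ord.
Qed.

Lemma hyperplane_diag h g d : basis_mx h = diag_mx d ->
  hyperplane (h * g)%g = \row_j (hyperplane g 0 j / d 0 j).
Proof.
move=> hd; have d0 j := basis_mx_diag_neq0 j hd.
apply/rowP => j; rewrite !mxE; apply: (mulIf (d0 j)); rewrite divfK //.
have : invmx (basis_mx (h * g)%g) *m basis_mx h = invmx (basis_mx g).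
  by rewrite -!basis_mxV invgM basis_mxM -mulmxA -basis_mxM mulVg /basis_mx
             conj1g mulmx1.
by move=> <-; rewrite hd mul_mx_diag mxE.
Qed.

(** The equation of the hyperplane is divided by d when the vectors are
    multiplied by d, and the two factors cancel. *)
Lemma balanced_diag h g d : basis_mx h = diag_mx d ->
  balanced (h * g)%g = balanced g.
Proof.
move=> hd; have d0 j := basis_mx_diag_neq0 j hd.
rewrite /balanced basis_mxM hd mulmxA mulmx_diag (hyperplane_diag _ hd).
by congr (diag_mx _ *m _); apply/rowP => j; rewrite !mxE divfK.
Qed.

Lemma balanced_borel g b : b \in borel P ->
  balanced (g * b)%g = balanced g *m ((last_diag b)^-1 *: basis_mx b).
Proof.
move=> bB; rewrite /balanced hyperplane_borel // basis_mxM mulmxA.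
by rewrite linearZ /= -!scalemxAl scalemxAr.
Qed.

Lemma generic_borel g b : b \in borel P -> generic g -> generic (g * b)%g.
Proof.
move=> bB gg j; rewrite hyperplane_borel // mxE mulf_neq0 // invr_neq0 //.
exact: borel_diag_neq0.
Qed.

Lemma generic_diag h g d : basis_mx h = diag_mx d ->
  generic (h * g)%g <-> generic g.
Proof.
move=> hd; have d0 j := basis_mx_diag_neq0 j hd.
have E j : (hyperplane (h * g)%g 0 j != 0) = (hyperplane g 0 j != 0).
  rewrite (hyperplane_diag _ hd) [LHS]/= [X in X != 0]mxE.
  by rewrite mulf_eq0 negb_or invr_eq0 d0 andbT.
by split=> gg j; [rewrite -E | rewrite E].
Qed.

Lemma hyperplane_mul g : hyperplane g *m basis_mx g = delta_mx 0 ord_max.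
Proof.
by rewrite /hyperplane -row_mul mulVmx ?basis_mx_unit // row1.
Qed.

(** All columns but the last lie in the hyperplane where the coordinates have
    sum 0. *)
Lemma balanced_sum g : const_mx 1 *m balanced g = delta_mx 0 ord_max :> 'rV_n.+1.
Proof.
rewrite /balanced mulmxA -(hyperplane_mul g); congr (_ *m _).
by rewrite mul_mx_diag; apply/rowP => j; rewrite !mxE mul1r.
Qed.

Lemma hyperplane_mx_unit g : generic g -> diag_mx (hyperplane g) \in unitmx.
Proof.
by move=> gg; rewrite unitmxE det_diag unitfE; apply/prodf_neq0 => j _; exact: gg.
Qed.

Lemma balanced_unit g : generic g -> balanced g \in unitmx.
Proof.
by move=> gg; rewrite unitmx_mul basis_mx_unit andbT hyperplane_mx_unit.
Qed.

Lemma regular_hyperplane : regular_mx setT hyperplane.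
Proof.
have oT : open (setT : set (GL k n.+1)) by exact: openT.
have := regular_mx_inv oT (fun g _ => basis_mx_unit g) regular_basis_mx.
move=> H i j; apply: eq_regular (H ord_max j) => // g _; by rewrite !mxE.
Qed.

Lemma regular_balanced : regular_mx setT balanced.
Proof.
have oT : open (setT : set (GL k n.+1)) by exact: openT.
apply: regular_mxM => //; last exact: regular_basis_mx.
move=> i j; apply: eq_regular (regularM _ _ _ oT (regular_hyperplane 0 i)
  (regular_cst _ (i == j)%:R oT)) => // g _.
by rewrite !mxE mulr_natr.
Qed.

End Coordinates.

(** * Flags with a generic hyperplane are semistable *)

(** Abel summation in multiplicative form: a dominant weight is a nonnegative
    combination of fundamental weights. *)
Lemma prod_pow_partial_prod (R : comPzRingType) (v : nat -> R) (a : nat -> nat) n :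
  (forall i, (i < n)%N -> (a i.+1 <= a i)%N) ->
  (\prod_(j < n) (\prod_(i < j.+1) v i) ^+ (a j - a j.+1)) *
    (\prod_(i < n) v i) ^+ a n = \prod_(i < n) v i ^+ a i.
Proof.
elim: n => [|n IH] da; first by rewrite !big_ord0 expr1n mulr1.
rewrite [in LHS]big_ord_recr /= -mulrA -exprD subnK; last exact: da.
rewrite !big_ord_recr /= exprMn mulrA IH // => i ni.
by apply: da; exact: ltnW.
Qed.

Section SemistableSection.
Variables (k : fieldType) (n : nat) (P : GL k n.+1) (chi : 'rV[int]_n.+1).
Hypothesis chi_sum : \sum_j chi 0 j = 0.
Hypothesis chi_pos : forall i : 'I_n, 0 < chi 0 (lift ord_max i).
Hypothesis chi_decr : forall i : 'I_n,
  chi 0 (lift ord0 i) <= chi 0 (lift ord_max i).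

(* The last entry of chi is negative; it is recovered from chi_sum, and the
   exponent is set to 0 from n on so that the Abel summation closes. *)
Let a (i : nat) : nat := if (i < n)%N then `|chi 0%R (inord i)|%N else 0%N.

Let inord_lift (i : 'I_n) : inord i = lift ord_max i :> 'I_n.+1.
Proof.
apply: val_inj; rewrite /= inordK; first exact: esym (lift_max i).
exact: leqW (ltn_ord i).
Qed.

Let aE (i : 'I_n) : chi 0 (lift ord_max i) = (a i)%:Z.
Proof.
by rewrite /a ltn_ord inord_lift gez0_abs //; exact: Order.POrderTheory.ltW.
Qed.

Let a_decr i : (i < n)%N -> (a i.+1 <= a i)%N.
Proof.
move=> i_n; have [i1n|] := ltnP i.+1 n; last by move=> ni; rewrite /a ltnNge ni.
have := chi_decr (Ordinal i_n); rewrite [X in _ <= X]aE.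
have -> : lift ord0 (Ordinal i_n) = lift ord_max (Ordinal i1n).
  by apply: val_inj; exact: esym (lift_max (Ordinal i1n)).
by rewrite aE.
Qed.

Let chi_max : chi 0 ord_max = - (\sum_(i < n) a i)%N%:Z.
Proof.
apply: (addrI ((\sum_(i < n) a i)%N%:Z)); rewrite subrr -chi_sum.
rewrite (bigD1_ord ord_max) //= addrC; congr (_ + _).
by rewrite (big_morph Posz PoszD (erefl _)); apply: eq_bigr => i _; rewrite aE.
Qed.

(** Dividing by the last diagonal entry absorbs the last, negative, entry of chi
    because the entries of chi have sum 0. *)
Lemma character_borel b : b \in borel P ->
  \prod_(i < n) ((last_diag P b)^-1 * basis_mx P b (inord i) (inord i)) ^+ a i =
  character P chi b.
Proof.
move=> bB; have c0 : last_diag P b != 0 by exact: borel_diag_neq0.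
rewrite /character (bigD1_ord ord_max) //= chi_max -/(basis_mx P b).
rewrite -/(last_diag P b) -invr_expz -exprnP mulrC.
rewrite (eq_bigr (fun i : 'I_n => basis_mx P b (inord i) (inord i) ^+ a i
   * (last_diag P b)^-1 ^+ a i)) => [|i _]; last by rewrite -exprMn mulrC.
rewrite big_split /= prodrXr exprVn; congr (_ * _).
apply: eq_bigr => i _; rewrite aE -exprnP.
by rewrite inord_lift.
Qed.

(** Invariant under all diagonal matrices, since [balanced] is; the exponents
    are the coordinates of chi on the fundamental weights. *)
Definition minor_section (A : 'M[k]_n.+1) (g : GL k n.+1) : k :=
  \prod_(j < n) \det (corner j.+1 (A *m balanced P g)) ^+ (a j - a j.+1).

Lemma minor_section_line_bundle A :
  line_bundle_sections P chi (minor_section A).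
Proof.
have oT : open (setT : set (GL k n.+1)) by exact: openT.
split=> [|g b bB].
  apply: regular_prod => // j _; apply: regularX => //.
  apply: regular_det => //; apply: regular_corner => //.
  by apply: regular_mxM => //; [exact: regular_mx_cst | exact: regular_balanced].
rewrite /minor_section balanced_borel //.
set v := fun i => (last_diag P b)^-1 * basis_mx P b (inord i) (inord i).
set u := _ *: basis_mx P b.
have tu : upper_trig u.
  by move=> i j ji; rewrite mxE (borelP _ _ bB) ?mulr0.
rewrite (eq_bigr (fun j : 'I_n => (\prod_(i < j.+1) v i) ^+ (a j - a j.+1) *
    \det (corner j.+1 (A *m balanced P g)) ^+ (a j - a j.+1))); last first.
  move=> j _; rewrite mulmxA corner_mul_upper // det_mulmx exprMn mulrC.
  congr (_ ^+ _ * _); rewrite det_corner_upper //.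
  rewrite (big_ord_widen n.+1 v); last by rewrite ltnS ltnW.
  by apply: eq_bigr => i _; rewrite mxE /v inord_val.
rewrite big_split /=; congr (_ * _).
have := prod_pow_partial_prod v a_decr.
have -> : a n = 0%N by rewrite /a ltnn.
by rewrite expr0 mulr1 => ->; exact: character_borel.
Qed.

Lemma character_neq0 (c : 'rV[int]_n.+1) b :
  b \in borel P -> character P c b != 0.
Proof.
move=> bB; apply/prodf_neq0 => j _.
by rewrite expfz_neq0 //; exact: borel_diag_neq0.
Qed.

(** The section attached to the inverse of the balanced frame of g takes the
    value 1 at g. *)
Lemma generic_semistable g :
  generic P g -> semistable P chi (\pi_(homogeneous_space (borel P)) g).
Proof.
move=> gg; exists 1%N, (minor_section (invmx (balanced P g))); split=> //.
- exact: minor_section_line_bundle.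
- move=> t h /andP[/is_diag_mxP dt _]; rewrite /minor_section.
  have /diag_mxP[d td] : is_diag_mx (basis_mx P t) by apply/is_diag_mxP.
  by rewrite (balanced_diag _ td).
- move=> h hg; have [_ fB] := minor_section_line_bundle (invmx (balanced P g)).
  have bB : (g^-1 * h)%g \in borel P by apply/borelP/pi_borelP.
  rewrite -(mulVKg g h) fB // mulf_neq0 ?character_neq0 //.
  rewrite /minor_section mulVmx ?balanced_unit //.
  apply/prodf_neq0 => j _.
  have -> : corner j.+1 (1%:M : 'M[k]_n.+1) = 1%:M.
    by apply/matrixP => x y; rewrite !mxE if_same.
  by rewrite det1 expr1n oner_eq0.
Qed.

End SemistableSection.

(** * Semistable flags have a generic hyperplane *)

(** Near x a regular function is a quotient of polynomials on some open set;
    multiplying both by a polynomial whose nonvanishing locus lies in that set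
    makes the equality hold wherever the denominator does not vanish. *)
Lemma regular_GL_fraction (k : fieldType) (n : nat) (f : GL k n -> k) (x : GL k n) :
  regular setT f -> exists s t : mpoly.mpoly (n * n) k,
    poly_eval t (GLmx x) != 0 /\
    forall y : GL k n, poly_eval t (GLmx y) != 0 ->
      f y = poly_eval s (GLmx y) / poly_eval t (GLmx y).
Proof.
move=> /(_ x I) [V [g [oV Vx rg fg]]].
have [s [t [tx gE]]] := rg _ Vx.
case: oV Vx fg gE => S -> [u Su ux] fg gE.
have evM (a b : mpoly.mpoly (n * n) k) y :
    poly_eval (a * b) y = poly_eval a y * poly_eval b y.
  exact: mpoly.mevalM.
exists (s * u), (t * u); rewrite evM mulf_neq0 //; split=> // y.
rewrite !evM mulf_eq0 negb_or => /andP[ty uy].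
have Vy : [set a | exists2 s, S s & poly_eval s a != 0]%classic (val y) by exists u.
by rewrite fg // gE // -mulf_div divff // mulr1.
Qed.

Lemma poly_eval_curve (k : fieldType) p q (C : 'M[{poly k}]_(p, q))
    (s : mpoly.mpoly (p * q) k) :
  exists Q : {poly k}, forall t,
    Q.[t] = poly_eval s (map_mx (horner_eval t) C).
Proof.
exists (\sum_(m <- mpoly.msupp s)
   (mpoly.mcoeff m s)%:P * \prod_i (mxvec C 0 i) ^+ (m i)) => t.
rewrite horner_sum /poly_eval /mpoly.meval /mpoly.mmap.
apply: eq_bigr => m _; rewrite hornerM hornerC; congr (_ * _).
rewrite /mpoly.mmap1 horner_prod; apply: eq_bigr => i _.
rewrite horner_exp; congr (_ ^+ _).
by case/mxvec_indexP: i => i j; rewrite !mxvecE mxE.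
Qed.

Lemma closed_field_root (k : closedFieldType) (n : nat) (x : k) :
  exists y, y ^+ n.+1 = x.
Proof.
have [y yE] := @solve_monicpoly k n.+1 (fun i => if i is 0%N then x else 0) isT.
exists y; rewrite yE big_ord_recl /= expr0 mulr1 big1 ?addr0 // => i _.
by rewrite mul0r.
Qed.

Section Unstable.
Variables (k : closedFieldType) (n : nat) (P : GL k n.+1) (chi : 'rV[int]_n.+1).
Hypothesis chi_sum : \sum_j chi 0 j = 0.
Hypothesis chi_pos : forall i : 'I_n, 0 < chi 0 (lift ord_max i).

(** If psi_i = 0 then e_i lies in the hyperplane of the flag; column operations
    in B put e_i itself among the columns, at the first step of the flag that
    contains it. *)
Lemma column_move (g : GL k n.+1) i : hyperplane P g 0 i = 0 ->
  exists b j, [/\ b \in borel P, j != ord_max &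
    forall a, basis_mx P (g * b)%g a j = (a == i)%:R].
Proof.
move=> hi; pose v := col i (invmx (basis_mx P g)).
have vE a : v a 0 = invmx (basis_mx P g) a i by rewrite mxE.
have Mv : basis_mx P g *m v = delta_mx i 0.
  by rewrite /v colE mulKVmx ?basis_mx_unit.
have [j0 vj0] : exists j, v j 0 != 0.
  apply/existsP; apply: contraT; rewrite negb_exists => /forallP v0.
  have : v = 0 by apply/colP => a; rewrite [RHS]mxE; apply/eqP; move: (v0 a); rewrite negbK.
  move=> v00; move: Mv; rewrite v00 mulmx0 => /matrixP/(_ i 0).
  by rewrite !mxE !eqxx => /eqP; rewrite eq_sym oner_eq0.
case: (@arg_maxnP _ j0 (fun j => v j 0 != 0) (fun j => j : nat) vj0) => j vj jmax.
pose u : 'M[k]_n.+1 := \matrix_(a, b) if b == j then v a 0 else (a == b)%:R.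
have tu : upper_trig u.
  move=> a b ba; rewrite [LHS]mxE; case: eqP => [E|_]; last by rewrite -val_eqE (gtn_eqF ba).
  apply/eqP; apply: contraTT ba => /jmax; rewrite E => aj.
  by rewrite -leqNgt.
have uu : u \in unitmx.
  rewrite unitmxE unitfE det_upper_trig //; apply/prodf_neq0 => a _.
  by rewrite mxE; have [->|_] := eqVneq a j; rewrite // eqxx oner_eq0.
exists (of_basis_mx P u), j; split.
- by apply/borelP; rewrite of_basis_mxK.
- by apply: contraNneq vj => ->; rewrite vE; move: hi; rewrite !mxE => ->.
- move=> a; rewrite basis_mxM of_basis_mxK //.
  have /matrixP/(_ a 0) := Mv; rewrite [RHS]mxE andbT => <-.
  by rewrite !mxE; apply: eq_bigr => l _; rewrite [u _ _]mxE eqxx.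
Qed.

(** The numerical criterion, by hand.  Let e_i be column j of the matrix M of g
    b.  Multiplying the other entries of row i by t is, up to scalars, the
    action of a one-parameter subgroup of T combined with an element of B that
    scales column j by t^-1.  The resulting curve C t extends to t = 0 inside
    GL_(n+1), and f (C 1) = t^e f (C t) with e = d chi_j > 0 because j is not
    the last index.  Letting t tend to 0 gives f (C 1) = 0. *)
Lemma nongeneric_section_eq0 (g : GL k n.+1) d f i : (0 < d)%N ->
  line_bundle_sections P (chi *+ d) f ->
  (forall t h, t \in torus P -> f (t * h)%g = f h) ->
  hyperplane P g 0 i = 0 -> exists2 b, b \in borel P & f (g * b)%g = 0.
Proof.
move=> d0 [rf fB] fT hi; have [b [j [bB jm gb]]] := column_move hi.
exists b => //; move ME: (basis_mx P (g * b)%g) gb => M gb.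
pose C (t : k) : 'M[k]_n.+1 := \matrix_(a, c)
  if (a == i) && (c != j) then t * M a c else M a c.
have Ccol t a : C t a j = (a == i)%:R by rewrite mxE eqxx andbF gb.
(* Row i and column j meet in the entry 1, and deleting them removes t. *)
have detC t : \det (C t) = \det M.
  rewrite !(expand_det_col _ j) (bigD1 i) // [RHS](bigD1 i) //= Ccol gb eqxx.
  rewrite !mul1r; congr (_ + _); last first.
    rewrite !big1 // => a ai; first by rewrite gb (negPf ai) mul0r.
    by rewrite Ccol (negPf ai) mul0r.
  congr (_ * \det _); apply/matrixP => a c; rewrite !mxE eq_sym.
  by rewrite (negPf (neq_lift _ _)).
have uC t : C t \in unitmx.
  by rewrite unitmxE detC -unitmxE -ME basis_mx_unit.
pose G t := of_basis_mx P (C t).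
have GE t : basis_mx P (G t) = C t by rewrite of_basis_mxK.
have [j' jE] : exists j' : 'I_n, j = lift ord_max j'.
  by case: (unliftP ord_max j) jm => [j' ->|->]; [exists j' | rewrite eqxx].
have [e e0 chiE] : exists2 e : nat, (0 < e)%N & (chi *+ d) 0 j = e%:Z.
  exists (`|chi 0%R j| * d)%N.
    by rewrite muln_gt0 d0 absz_gt0 jE Order.POrderTheory.gt_eqF.
  rewrite mulmxnE PoszM gez0_abs; first by rewrite -mulr_natr natz.
  by rewrite jE Order.POrderTheory.ltW.
(* A root s of t of order n + 1 is needed to write the one-parameter subgroup
   with determinant 1. *)
have key s : s != 0 -> f (g * b)%g = f (G (s ^+ n.+1)) * (s ^+ n.+1) ^+ e.
  move=> s0; set t := s ^+ n.+1; have t0 : t != 0 by rewrite expf_neq0.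
  pose l := \row_(a < n.+1) if a == i then s ^+ n else s^-1.
  pose r := \row_(c < n.+1) if c == j then s / t else s.
  have detl : \prod_a l 0 a = 1.
    rewrite (bigD1 i) //= mxE eqxx.
    rewrite (eq_bigr (fun=> s^-1)) => [|a ai]; last by rewrite mxE (negPf ai).
    by rewrite prodr_const cardC1 card_ord -exprMn divff // expr1n.
  have ul : diag_mx l \in unitmx by rewrite unitmxE det_diag detl unitr1.
  have r0 c : r 0 c != 0 by rewrite mxE; case: ifP; rewrite ?mulf_neq0 ?invr_neq0.
  have ur : diag_mx r \in unitmx.
    by rewrite unitmxE det_diag unitfE; apply/prodf_neq0.
  have -> : G t = (of_basis_mx P (diag_mx l) *
                  ((g * b) * of_basis_mx P (diag_mx r)))%g.
    apply: (@basis_mx_inj _ _ P); rewrite GE !(basis_mxM P _ _) !of_basis_mxK //.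
    rewrite -basis_mxM ME; apply/matrixP => a c.
    rewrite mul_diag_mx mul_mx_diag !mxE.
    have [->|ai] := eqVneq a i; have [->|cj] := eqVneq c j => /=.
    - by rewrite gb eqxx mul1r mulrA -exprSr divff.
    - by rewrite /t exprSr -mulrA [s * _]mulrC.
    - by rewrite gb (negPf ai) mul0r mulr0.
    - by rewrite mulrCA mulVf // mulr1.
  rewrite (fT (of_basis_mx P (diag_mx l))); last exact: diag_torus.
  have rB : of_basis_mx P (diag_mx r) \in borel P.
    apply/borelP; rewrite of_basis_mxK // => a c ca.
    by rewrite mxE -val_eqE (gtn_eqF ca).
  rewrite (fB (g * b)%g _ rB) /character -/(basis_mx P _) of_basis_mxK //.
  rewrite (bigD1 j) //= chiE -exprnP [\prod_(c | _) _](_ : _ = s ^ (- e%:Z)); last first.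
    have -> : - e%:Z = \sum_(c < n.+1 | c != j) (chi *+ d) 0 c.
      have : \sum_c (chi *+ d) 0 c = 0.
        by under eq_bigr do rewrite mulmxnE; rewrite sumrMnl chi_sum mul0rn.
      by rewrite (bigD1 j) //= chiE addrC => /eqP; rewrite addr_eq0 => /eqP.
    rewrite (big_morph (fun z => s ^ z) (fun x y => expfzDr x y s0) (expr0z s)).
    by apply: eq_bigr => c cj; rewrite !mxE eqxx (negPf cj).
  have -> : diag_mx r j j = s / t by rewrite !mxE !eqxx.
  rewrite -exprnN exprMn exprVn -mulrA [f _ * _]mulrC mulrA.
  by rewrite mulrAC divff ?expf_neq0 // mul1r mulVf ?mul1r // expf_neq0.
(* Letting t tend to 0 is done on polynomials: f is p / q near C 0, so q f(g
   b) and t^e p agree along the curve wherever t and q do not vanish. *)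
have [p [q [q0 fE]]] := regular_GL_fraction (G 0) rf.
pose Cp : 'M[{poly k}]_n.+1 := map_mx polyC (GLmx P) *m
  ((\matrix_(a, c) if (a == i) && (c != j) then 'X * (M a c)%:P else (M a c)%:P)
   *m map_mx polyC (invmx (GLmx P))).
have CpE t : map_mx (horner_eval t) Cp = GLmx (G t).
  have cE (A : 'M[k]_n.+1) : map_mx (horner_eval t) (map_mx polyC A) = A.
    by apply/matrixP => a c; rewrite !mxE /horner_eval hornerC.
  rewrite !map_mxM !cE.
  have -> : map_mx (horner_eval t) (\matrix_(a, c) if (a == i) && (c != j)
       then 'X * (M a c)%:P else (M a c)%:P) = C t.
    apply/matrixP => a c; rewrite !mxE /horner_eval.
    by case: ifP => _; rewrite ?hornerM ?hornerX hornerC.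
  by rewrite -GE -GLmx_basis_mx.
have [p' p'E] := poly_eval_curve Cp p; have [q' q'E] := poly_eval_curve Cp q.
apply/eqP; apply: contraTT isT => fgb.
(* The factors q' and 'X confine the nonroot of R to the points where the
   equality of fractions is available. *)
pose R := ((f (g * b)%g)%:P * q' - 'X^e * p') * q' * 'X.
have q'0 : q'.[0] != 0 by rewrite q'E CpE.
have R0 : R != 0.
  rewrite !mulf_neq0 ?polyX_eq0 //.
    apply: contraNneq (mulf_neq0 fgb q'0) => E.
    have := congr1 (fun r : {poly k} => r.[0]) E; rewrite !hornerE.
    by rewrite ?hornerXn expr0n gtn_eqF // mul0r subr0 => ->.
  by apply: contraNneq q'0 => ->; rewrite horner0.
have [t] := closed_nonrootP R R0.
rewrite /root !hornerE !mulf_eq0 !negb_or => /andP[/andP[Rt qt] t0].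
have [s sE] := closed_field_root n t.
have s0 : s != 0 by apply: contraNneq t0 => s0; rewrite -sE s0 expr0n.
move: Rt; rewrite (key s s0) sE fE; last by rewrite -CpE -q'E.
rewrite -!CpE -p'E -q'E ?hornerXn mulrAC divfK // mulrC subrr eqxx.
done.
Qed.

Lemma semistable_generic (g : GL k n.+1) :
  semistable P chi (\pi_(homogeneous_space (borel P)) g) -> generic P g.
Proof.
move=> [d [f [d0 sf fT f0]]] i; apply/eqP => hi.
have [b bB fb] := nongeneric_section_eq0 d0 sf fT hi.
suff /f0 : \pi_(homogeneous_space (borel P)) (g * b)%g = \pi g by rewrite fb eqxx.
by apply/esym/pi_borelP; rewrite mulKg; apply/borelP.
Qed.

End Unstable.

(** * The slice of flags lying in a fixed hyperplane *)

Lemma basis_mx_embed (k : fieldType) n (P : GL k n.+1) (h : GL k n) :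
  basis_mx P (embed P h) = embed_mx (GLmx h).
Proof. by rewrite /basis_mx /embed conjgKV. Qed.

Lemma borel_subP (k : fieldType) n (P : GL k n.+1) (h : GL k n) :
  reflect (upper_trig (GLmx h)) (h \in borel_sub P).
Proof.
rewrite inE; apply: (iffP (borelP _ _)); rewrite basis_mx_embed.
  by move/upper_left_trig; rewrite upper_left_embed.
exact: embed_mx_upper.
Qed.

Lemma pi_borel_subP (k : fieldType) n (P : GL k n.+1) (g h : GL k n) :
  \pi_(homogeneous_space (borel_sub P)) g = \pi h <->
  upper_trig (GLmx (g^-1 * h)%g).
Proof.
split=> [/(iffLR (pi_lcosetP (borel_sub P) _ _))/borel_subP //|/(borel_subP P) gh].
exact: (iffRL (pi_lcosetP (borel_sub P) _ _)).
Qed.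

Section Morphisms.
Variable k : fieldType.

Lemma morphism_on_GL (X : spaceWithFunctions k) (U : set X) n (F : X -> GL k n) :
  open U -> regular_mx U (fun x => GLmx (F x)) -> morphism_on U F.
Proof.
move=> oU rF; apply: (@morphism_on_sub _ _ _ _ U (F : X -> set_type _)).
exact: morphism_on_regular_mx.
Qed.

Lemma regular_embed_mx (X : spaceWithFunctions k) (U : set X) n
    (F : X -> 'M[k]_n) :
  open U -> regular_mx U F -> regular_mx U (fun x => embed_mx (F x)).
Proof.
move=> oU rF i j; case: (unliftP ord_max i) => [i'|] ->; last first.
  apply: (eq_regular oU _ (regular_cst _ _ oU)) => x _.
  by rewrite embed_mx_last_row.
case: (unliftP ord_max j) => [j'|] ->.
  by apply: (eq_regular oU _ (rF i' j')) => x _; rewrite embed_mxE.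
apply: (eq_regular oU _ (regular_cst _ _ oU)) => x _.
by rewrite embed_mx_last_col.
Qed.

Lemma regular_row_mx (X : spaceWithFunctions k) (U : set X) p q r
    (F : X -> 'M[k]_(p, q)) (G : X -> 'M[k]_(p, r)) :
  open U -> regular_mx U F -> regular_mx U G ->
  regular_mx U (fun x => row_mx (F x) (G x)).
Proof.
move=> oU rF rG i j; case: (splitP j) => l jl.
  have -> : j = lshift r l by exact: val_inj.
  by apply: (eq_regular oU _ (rF i l)) => x _; rewrite row_mxEl.
have -> : j = rshift q l by exact: val_inj.
by apply: (eq_regular oU _ (rG i l)) => x _; rewrite row_mxEr.
Qed.

Lemma regular_upper_left (X : spaceWithFunctions k) (U : set X) n
    (F : X -> 'M[k]_n.+1) :
  open U -> regular_mx U F -> regular_mx U (fun x => upper_left (F x)).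
Proof.
by move=> oU rF i j; apply: (eq_regular oU _ (rF _ _)) => x _; rewrite mxE.
Qed.

End Morphisms.

Section Diagonal.
Variables (k : closedFieldType) (n : nat) (P : GL k n.+1).

(** Any diagonal matrix is a scalar times one of determinant 1, as k has roots
    of order n + 1, and scalars act trivially on flags. *)
Lemma translate_diag_torus h d : basis_mx P h = diag_mx d ->
  exists2 t, t \in torus P &
    forall x : homogeneous_space (borel P), translate h x = translate t x.
Proof.
move=> hd; have d0 j := basis_mx_diag_neq0 j hd.
have [c cE] := closed_field_root n (\prod_j d 0 j).
have c0 : c != 0.
  have : \prod_j d 0 j != 0 by apply/prodf_neq0.
  by apply: contraNneq => c0; rewrite -cE c0 expr0n.
have uc : (c%:M : 'M[k]_n.+1) \in unitmx by rewrite unitmxE det_scalar unitfE expf_neq0.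
pose e := \row_j (d 0 j / c).
have ue : diag_mx e \in unitmx.
  rewrite unitmxE det_diag unitfE; apply/prodf_neq0 => j _.
  by rewrite mxE mulf_neq0 ?invr_neq0.
exists (of_basis_mx P (diag_mx e)).
  apply: diag_torus; under eq_bigr do rewrite mxE.
  by rewrite big_split /= prodr_const card_ord exprVn cE divff // -cE expf_neq0.
move=> x; rewrite -[x]reprK !translate_pi; apply/esym/pi_borelP.
have -> : ((of_basis_mx P (diag_mx e) * repr x)^-1 * (h * repr x) =
          of_basis_mx P c%:M)%g.
  apply: (@mulgI _ (of_basis_mx P (diag_mx e) * repr x)%g); rewrite mulVKg.
  apply: (@basis_mx_inj _ _ P); rewrite !basis_mxM !of_basis_mxK // hd.
  rewrite mul_mx_scalar scalemxAl; congr (_ *m _).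
  by rewrite -linearZ; congr diag_mx; apply/rowP => j; rewrite !mxE mulrCA divff ?mulr1.
by rewrite of_basis_mxK // => i j ji; rewrite mxE -val_eqE gtn_eqF.
Qed.

End Diagonal.

Section Slice.
Local Open Scope classical_set_scope.
Variables (k : fieldType) (n : nat) (P : GL k n.+1) (D : 'M[k]_n.+1).
Hypothesis D_unit : D \in unitmx.
(* In the frame D the sum of the coordinates is the last coordinate, so the
   first n vectors of D form a basis of the hyperplane where this sum is 0. *)
Hypothesis D_sum : const_mx 1 *m D = delta_mx 0 ord_max :> 'rV_n.+1.
Local Notation X := (homogeneous_space (borel P)).
Local Notation Y := (homogeneous_space (borel_sub P)).

(** In the frame D the balanced frame of g has last row (0, ..., 0, 1); the
    remaining block is the matrix of a flag of the hyperplane spanned by the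
    first n vectors of D. *)
Definition slice_mx (g : GL k n.+1) : 'M[k]_n :=
  upper_left (invmx D *m balanced P g).

Lemma slice_last_row g : last_row_unit (invmx D *m balanced P g).
Proof.
move=> j; have := balanced_sum P g.
rewrite -{1}(mulKVmx D_unit (balanced P g)) (mulmxA (const_mx 1)) D_sum -rowE.
by move=> /rowP/(_ j); rewrite [LHS]mxE => ->; rewrite mxE eqxx.
Qed.

Lemma slice_mx_unit g : generic P g -> slice_mx g \in unitmx.
Proof.
move=> gg; rewrite unitmxE -det_upper_left; last exact: slice_last_row.
by rewrite -unitmxE unitmx_mul unitmx_inv D_unit balanced_unit.
Qed.

Definition slice (g : GL k n.+1) : GL k n := GL_of_mx (slice_mx g).

Lemma sliceE g : generic P g -> GLmx (slice g) = slice_mx g.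
Proof. by move=> gg; rewrite GL_of_mxK // slice_mx_unit. Qed.

Lemma slice_borel g b : generic P g -> b \in borel P ->
  \pi_Y (slice (g * b)%g) = \pi_Y (slice g).
Proof.
move=> gg bB; have ggb := generic_borel bB gg.
apply/esym/pi_borel_subP.
have tc : upper_trig ((last_diag P b)^-1 *: basis_mx P b).
  by move=> i j ji; rewrite mxE (borelP _ _ bB) ?mulr0.
suff -> : GLmx ((slice g)^-1 * slice (g * b))%g =
    upper_left ((last_diag P b)^-1 *: basis_mx P b) by exact: upper_left_trig.
have tr j : ((last_diag P b)^-1 *: basis_mx P b) ord_max (lift ord_max j) = 0.
  by rewrite tc // lift_max ltn_ord.
rewrite GLmxM GLmxV !sliceE // /slice_mx balanced_borel //.
by rewrite (mulmxA _ _ (_ *: _)) (upper_leftM _ tr) mulKmx // slice_mx_unit.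
Qed.

Lemma slice_diag h g d : basis_mx P h = diag_mx d -> slice (h * g)%g = slice g.
Proof. by move=> hd; rewrite /slice /slice_mx (balanced_diag _ hd). Qed.

Definition slice_section (h : GL k n) : GL k n.+1 :=
  (of_basis_mx P D * embed P h)%g.

Lemma slice_sectionE h : basis_mx P (slice_section h) = D *m embed_mx (GLmx h).
Proof. by rewrite basis_mxM of_basis_mxK // basis_mx_embed. Qed.

Lemma hyperplane_section h : hyperplane P (slice_section h) = const_mx 1.
Proof.
apply: (can_inj (mulmxK (basis_mx_unit P (slice_section h)))).
rewrite hyperplane_mul slice_sectionE mulmxA D_sum -rowE.
by apply/rowP => j; rewrite [RHS]mxE embed_mx_last_row mxE eqxx.
Qed.

Lemma generic_section h : generic P (slice_section h).
Proof. by move=> j; rewrite hyperplane_section mxE oner_eq0. Qed.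

Lemma sliceK h : slice (slice_section h) = h.
Proof.
apply: val_inj; change (GLmx (slice (slice_section h)) = GLmx h).
rewrite sliceE; last exact: generic_section.
rewrite /slice_mx /balanced hyperplane_section diag_const_mx mul1mx slice_sectionE.
by rewrite mulKmx // upper_left_embed.
Qed.

Lemma section_borel h b : b \in borel_sub P ->
  \pi_X (slice_section (h * b)%g) = \pi_X (slice_section h).
Proof.
move=> bB; apply/esym/pi_borelP/borelP.
have -> : slice_section (h * b)%g = (slice_section h * embed P b)%g.
  by rewrite /slice_section embedM mulgA.
by rewrite mulKg.
Qed.

(** Modulo B the last column of the balanced frame is irrelevant, so the flag of
    the balanced frame is the completion of its slice. *)
Lemma section_slice h g : generic P g ->
  basis_mx P h = diag_mx (hyperplane P g) ->
  \pi_X (h * g)%g = \pi_X (slice_section (slice g)).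
Proof.
move=> gg hE; apply/esym/pi_borelP.
have E : ((slice_section (slice g))^-1 * (h * g) =
    embed P (slice g)^-1 * ((of_basis_mx P D)^-1 * (h * g)))%g.
  rewrite /slice_section invgM -mulgA; congr (_ * _)%g.
  by apply: (@mulgI _ (embed P (slice g))); rewrite mulgV -embedM mulgV;
     apply: (@mulgI _ (embed P 1%g)); rewrite -embedM !mulg1.
rewrite E basis_mxM basis_mx_embed basis_mxM basis_mxV of_basis_mxK //.
rewrite basis_mxM hE -/(balanced P g).
have lA := slice_last_row g.
apply: upper_trig_last_row.
  move=> j; rewrite mxE (bigD1_ord ord_max) //= big1 => [|l _].
    by rewrite embed_mx_last_row eqxx mul1r addr0 lA.
  by rewrite embed_mx_last_row eq_sym (negPf (neq_lift _ _)) mul0r.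
rewrite upper_leftM => [|j]; last by rewrite lA eq_sym (negPf (neq_lift _ _)).
by rewrite upper_left_embed GLmxV sliceE // mulVmx ?slice_mx_unit.
Qed.

Lemma open_generic : open [set g : GL k n.+1 | generic P g].
Proof.
have oT : open (setT : set (GL k n.+1)) by exact: openT.
have := open_nonzero oT (@regular_prod _ _ _ _ (index_enum _) xpredT
  (fun j g => hyperplane P g 0 j) oT (fun j _ => regular_hyperplane P 0 j)).
rewrite setTI; congr open; apply/seteqP; split=> g /=.
  by move=> /prodf_neq0 H j; exact: H.
by move=> gg; apply/prodf_neq0 => j _; exact: gg.
Qed.

Lemma morphism_on_slice : morphism_on [set g | generic P g] slice.
Proof.
apply: morphism_on_GL; first exact: open_generic.
have o := open_generic.
have rs : regular_mx [set g | generic P g] slice_mx.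
  apply: regular_upper_left => //; apply: regular_mxM => //.
    exact: regular_mx_cst.
  move=> i j; apply: sub_regular_on (regular_balanced P i j) => //.
  exact: openT.
by move=> i j; apply: (eq_regular o _ (rs i j)) => g gg; rewrite sliceE.
Qed.

Lemma morphism_on_section : morphism_on setT slice_section.
Proof.
have o : open (setT : set (GL k n)) by exact: openT.
apply: morphism_on_GL => //.
have r A : regular_mx (setT : set (GL k n)) (fun=> A : 'M[k]_n.+1).
  exact: regular_mx_cst.
have := regular_mxM o (r (GLmx P)) (regular_mxM o (r D) (regular_mxM o
  (regular_embed_mx o (@regular_mx_comp _ _ _ _ _ _ (@morphism_on_val _ _ _)))
  (r (invmx (GLmx P))))).
move=> H i j; apply: (eq_regular o _ (H i j)) => h _.
by rewrite [in RHS](GLmx_basis_mx P) slice_sectionE !mulmxA.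
Qed.

End Slice.

(** * Good quotients that admit a section *)

Section GeometricQuotient.
Local Open Scope classical_set_scope.
Variables (k : fieldType) (X Y : spaceWithFunctions k) (R : X -> X -> Prop).
Variables (pi : X -> Y) (s : Y -> X).
Hypotheses (pi_morphism : morphism pi) (s_morphism : morphism s).
Hypothesis sK : cancel s pi.
Hypothesis pi_invariant : forall x x', R x x' -> pi x = pi x'.
Hypothesis orbit_section : forall x, R x (s (pi x)).

(** The section turns images of invariant sets into preimages; closedness and
    disjointness of images become trivial. *)
Lemma image_invariant (Z : set X) :
  (forall x x', R x x' -> Z x -> Z x') -> pi @` Z = s @^-1` Z.
Proof.
move=> RZ; apply/seteqP; split=> [_ [x Zx <-]|y Zy] /=; first exact: RZ Zx.
by exists (s y).
Qed.

Lemma good_quotient_section : affine_morphism pi -> good_quotient R pi.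
Proof.
move=> aff; split=> //.
- by move=> y; exists (s y).
- move=> V g oV rg inv; exists (g \o s).
    have -> : V = s @^-1` (pi @^-1` V).
      by apply/seteqP; split=> y /=; rewrite sK.
    apply: s_morphism.2 rg.
    by have /continuousP := pi_morphism.1; apply.
  by move=> x Vx; exact: inv.
- move=> Z cZ RZ; rewrite image_invariant //.
  by have /continuous_closedP := s_morphism.1; apply.
- by move=> Z Z' _ _ RZ RZ' ZZ'; rewrite !image_invariant // -preimage_setI ZZ'.
Qed.

(** The fibres of pi are closed invariant sets, so a good quotient q separates
    them; thus q and pi have the same fibres.  The bijection is then a morphism
    one way because q is a good quotient, and the other way because it is the
    composite of q with the section. *)
Lemma good_quotient_unique (Y' : spaceWithFunctions k) (q : X -> Y') :
  (forall y : Y, closed [set y]) -> good_quotient R q ->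
  exists2 phi : Y' -> Y, isomorphism phi & forall x, phi (q x) = pi x.
Proof.
move=> cY gq.
have qR := good_quotient_invariant gq.
have fib x x' : q x = q x' -> pi x = pi x'.
  move=> qx; apply: contrapT => nx.
  pose Z y := pi @^-1` [set pi y].
  have cZ y : closed (Z y).
    by have /continuous_closedP := pi_morphism.1; apply.
  have RZ y z z' : R z z' -> Z y z -> Z y z' by move=> /pi_invariant; rewrite /Z /= => ->.
  have ZZ : Z x `&` Z x' = set0.
    by apply/seteqP; split=> z //= -[]; rewrite /Z /= => -> /nx.
  have := good_quotient_disjoint gq (cZ x) (cZ x') (RZ x) (RZ x') ZZ.
  move=> /seteqP[/(_ (q x)) H _]; apply: H; split; first by exists x.
  by exists x'.
have [r rE] := choice (good_quotient_surj gq).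
pose phi y := pi (r y); have phiE x : phi (q x) = pi x by apply: fib.
have psiE x : q (s (pi x)) = q x by apply/esym/qR.
exists phi => //; split; last first.
  exists (q \o s); split.
  - exact: morphism_comp s_morphism (good_quotient_morphism gq).
  - by move=> y; rewrite -(rE y) phiE /= psiE.
  - by move=> y /=; rewrite phiE sK.
have cphi V : open V -> open (phi @^-1` V).
  move=> oV.
  have -> : phi @^-1` V = ~` (q @` (pi @^-1` (~` V))).
    apply/seteqP; split=> y /=; first by move=> Vy [x nx yx]; apply: nx; rewrite -phiE yx.
    by move=> H; apply: contrapT => nV; apply: H; exists (r y).
  apply: closed_openC; apply: (good_quotient_closed gq).
    by have /continuous_closedP := pi_morphism.1; apply; exact: open_closedC.
  by move=> x x' /pi_invariant /= ->.
split=> [|V h oV rh]; first by apply/continuousP.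
have E : q @^-1` (phi @^-1` V) = pi @^-1` V.
  by apply/seteqP; split=> x /=; rewrite phiE.
have rg : regular (q @^-1` (phi @^-1` V)) (h \o pi).
  by rewrite E; exact: pi_morphism.2.
have [x x' _ /pi_invariant /= -> //|f rf fE] :=
  good_quotient_functions gq (cphi _ oV) rg.
apply: eq_regular rf => [|y Vy]; first exact: cphi.
by rewrite -(rE y) /= phiE -fE //= phiE -?phiE ?rE.
Qed.

End GeometricQuotient.

Section AffineCriteria.
Local Open Scope classical_set_scope.
Variable k : fieldType.

(** Charts are checked more easily as mutually inverse maps into the ambient
    affine space than with the closed subspace as codomain. *)
Lemma affine_embedding (X : spaceWithFunctions k) p q
    (Z : set (affine_space k p q)) (F : X -> affine_space k p q) (G : Z -> X) :
  closed Z -> (forall x, Z (F x)) -> morphism F -> morphism G ->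
  (forall x z, val z = F x -> G z = x) -> (forall z, F (G z) = val z) -> affine X.
Proof.
move=> cZ ZF mF mG GF FG.
pose f x : Z := exist _ (F x) (mem_set (ZF x)).
exists p, q, Z, f; split=> //; split.
  by apply/morphism_onT/morphism_on_sub/morphism_onT.
exists G; split=> // [x|z]; first exact: GF.
by apply: val_inj; exact: FG.
Qed.

Lemma closed_zeros (X : spaceWithFunctions k) (I : Type) (h : I -> X -> k) :
  (forall i, regular setT (h i)) -> closed [set x | forall i, h i x = 0].
Proof.
move=> rh; rewrite -openC.
have -> : ~` [set x | forall i, h i x = 0] =
    \bigcup_i (setT `&` [set x | h i x != 0]).
  apply/seteqP; split=> x /=.
    by move=> /existsNP[i /eqP hi]; exists i.
  by move=> [i _ [_ /eqP hi]] H; exact: hi.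
by apply: bigcup_open => i _; apply: open_nonzero => //; exact: openT.
Qed.

Lemma closed_eq (X : spaceWithFunctions k) (I : Type) (f g : I -> X -> k) :
  (forall i, regular setT (f i)) -> (forall i, regular setT (g i)) ->
  closed [set x | forall i, f i x = g i x].
Proof.
have oT : open (setT : set X) by exact: openT.
move=> rf rg; have := @closed_zeros X I (fun i x => f i x + - g i x).
set Z := (X in closed X); suff -> : [set x | forall i, f i x = g i x] = Z.
  by apply=> i; apply: regularD => //; exact: regularN.
apply/seteqP; split=> x H i; first by rewrite /= H subrr.
by apply/eqP; rewrite -subr_eq0; exact/eqP/H.
Qed.

End AffineCriteria.

(** * The quotient of the semistable locus *)

(** Coordinates on the torus modulo scalars that treat all indices alike: the
    vectors with nonzero entries, up to scalars, correspond to the matrices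
    satisfying [cocycle_mx], a closed condition. *)
Definition ratio_mx (k : fieldType) n (v : 'rV[k]_n) : 'M[k]_n :=
  \matrix_(i, j) (v 0 i / v 0 j).

Definition cocycle_mx (k : fieldType) n (Q : 'M[k]_n) : Prop :=
  (forall i, Q i i = 1) /\ forall i j l, Q i j * Q j l = Q i l.

Lemma cocycle_ratio_mx (k : fieldType) n (v : 'rV[k]_n) :
  (forall i, v 0 i != 0) -> cocycle_mx (ratio_mx v).
Proof.
move=> v0; split=> [i|i j l]; rewrite !mxE ?divff //.
by rewrite mulrA divfK.
Qed.

Lemma cocycle_mx_neq0 (k : fieldType) n (Q : 'M[k]_n) i j :
  cocycle_mx Q -> Q i j != 0.
Proof.
move=> [Q1 QM]; apply/eqP => Q0.
by have := QM i j i; rewrite Q0 mul0r Q1 => /eqP; rewrite eq_sym oner_eq0.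
Qed.

Section QuotientMap.
Local Open Scope classical_set_scope.
Variables (k : closedFieldType) (n : nat) (P : GL k n.+1).
Variable chi : 'rV[int]_n.+1.
Hypothesis semistableP : forall g,
  semistable P chi (\pi_(homogeneous_space (borel P)) g) <-> generic P g.
Variable D : 'M[k]_n.+1.
Hypothesis D_unit : D \in unitmx.
Hypothesis D_sum : const_mx 1 *m D = delta_mx 0 ord_max :> 'rV_n.+1.
Local Notation X := (homogeneous_space (borel P)).
Local Notation Y := (homogeneous_space (borel_sub P)).
Local Notation Xss := (semistable P chi).

Lemma generic_repr (x : Xss) : generic P (repr (val x)).
Proof. by apply/semistableP; rewrite reprK; exact: set_mem (valP x). Qed.

Lemma generic_pi (x : Xss) g : val x = \pi_X g -> generic P g.
Proof. by move=> xg; apply/semistableP; rewrite -xg; exact: set_mem (valP x). Qed.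

Lemma repr_borel g : exists2 b, b \in borel P & repr (\pi_X g) = (g * b)%g.
Proof.
exists (g^-1 * repr (\pi_X g))%g; last by rewrite mulVKg.
by apply/borelP/(iffLR (pi_borelP P _ _)); rewrite reprK.
Qed.

Lemma generic_pi_repr g : generic P (repr (\pi_X g)) <-> generic P g.
Proof. by rewrite -!semistableP reprK. Qed.

(** Defined on all flags, with junk values where the hyperplane is not generic. *)
Definition flag_slice (x : X) : Y := \pi_Y (slice P D (repr x)).

Lemma flag_slice_pi g : generic P g -> flag_slice (\pi_X g) = \pi_Y (slice P D g).
Proof.
move=> gg; rewrite /flag_slice; have [b bB ->] := repr_borel g.
exact: slice_borel.
Qed.

Definition quotient_map (x : Xss) : Y := flag_slice (val x).

Lemma quotient_mapE (x : Xss) g : val x = \pi_X g ->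
  quotient_map x = \pi_Y (slice P D g).
Proof.
by move=> xg; rewrite /quotient_map xg flag_slice_pi //; exact: generic_pi xg.
Qed.

Lemma section_semistable (y : Y) : \pi_X (slice_section P D (repr y)) \in Xss.
Proof. by apply/mem_set/semistableP; exact: generic_section. Qed.

Definition quotient_section (y : Y) : Xss :=
  exist _ (\pi_X (slice_section P D (repr y))) (section_semistable y).

Lemma slice_section_pi h h' : \pi_Y h = \pi_Y h' ->
  \pi_X (slice_section P D h) = \pi_X (slice_section P D h').
Proof.
move=> hh'; have bB : (h^-1 * h')%g \in borel_sub P.
  by apply/borel_subP/(iffLR (pi_borel_subP P _ _)).
by have := section_borel D h bB; rewrite mulVKg => ->.
Qed.

Lemma quotient_section_pi h :
  val (quotient_section (\pi_Y h)) = \pi_X (slice_section P D h).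
Proof. by apply: slice_section_pi; rewrite reprK. Qed.

Lemma quotient_sectionK : cancel quotient_section quotient_map.
Proof.
move=> y; rewrite -[in LHS](reprK y) (quotient_mapE (quotient_section_pi _)).
by rewrite sliceK // reprK.
Qed.

Lemma quotient_map_invariant (x x' : Xss) :
  torus_orbit x x' -> quotient_map x = quotient_map x'.
Proof.
move=> [t /andP[/diag_mxP[d td] _] xx'].
have xE : val x = \pi_X (repr (val x)) by rewrite reprK.
rewrite (quotient_mapE xE) (@quotient_mapE x' (t * repr (val x))%g); last first.
  by rewrite xx' -[in LHS](reprK (val x)) translate_pi.
by rewrite (@slice_diag _ _ P _ t _ d).
Qed.

(** The diagonal matrix of the equation of the hyperplane carries a flag to its
    balanced form; up to a scalar it is in T. *)
Lemma quotient_map_orbit (x : Xss) : torus_orbit x (quotient_section (quotient_map x)).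
Proof.
have [g xg] : exists g, val x = \pi_X g.
  by exists (repr (val x)); rewrite reprK.
have gg := generic_pi xg; have hE := of_basis_mxK P (hyperplane_mx_unit gg).
have [t tT tE] := translate_diag_torus hE.
exists t => //; rewrite -tE xg translate_pi (section_slice D_unit D_sum gg hE).
by rewrite (quotient_mapE xg); exact: quotient_section_pi.
Qed.

Let Xgen : set X := [set x | generic P (repr x)].

Let open_Xgen : open Xgen.
Proof.
change (open (\pi_X @^-1` Xgen)).
have -> : \pi_X @^-1` Xgen = [set g | generic P g].
  by apply/seteqP; split=> g; [exact: (generic_pi_repr g).1|exact: (generic_pi_repr g).2].
exact: open_generic.
Qed.

Let val_Xgen : val @^-1` Xgen = [set: Xss].
Proof. by apply/seteqP; split=> // x _; exact: generic_repr. Qed.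

Lemma morphism_on_flag_slice : morphism_on Xgen flag_slice.
Proof.
apply: morphism_on_quotient.
apply: (@eq_morphism_on _ _ _ _ (\pi_Y \o slice P D)).
  by move=> g /(generic_pi_repr g).1 gg; rewrite /= flag_slice_pi.
have := morphism_on_comp (morphism_on_slice P D_unit D_sum)
  (@morphism_on_pi _ _ (lcosets (borel_sub P))).
rewrite preimage_setT setIT; apply: sub_morphism_on; first exact: open_Xgen.
by move=> g /(generic_pi_repr g).1.
Qed.

Lemma quotient_map_morphism : morphism quotient_map.
Proof.
apply/morphism_onT.
have := morphism_on_comp (@morphism_on_val _ _ Xss) morphism_on_flag_slice.
by rewrite setTI val_Xgen.
Qed.

Lemma quotient_section_morphism : morphism quotient_section.
Proof.
apply/morphism_onT/morphism_on_sub/morphism_on_quotient.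
apply: (@eq_morphism_on _ _ _ _ (\pi_X \o slice_section P D)).
  by move=> h _; exact: esym (quotient_section_pi h).
have := morphism_on_comp (morphism_on_section P D_unit)
  (@morphism_on_pi _ _ (lcosets (borel P))).
by rewrite preimage_setT setIT.
Qed.

(** The fibre over y is a coset of the upper triangular group, defined by the
    vanishing of entries. *)
Lemma closed_point (y : Y) : closed [set y].
Proof.
have oT : open (setT : set (GL k n)) by exact: openT.
rewrite -openC; change (open (\pi_Y @^-1` (~` [set y]))).
pose h := repr y.
have -> : \pi_Y @^-1` (~` [set y]) = \bigcup_(p in [set p : 'I_n * 'I_n | (p.2 < p.1)%N])
    (setT `&` [set g | (invmx (GLmx h) *m GLmx g) p.1 p.2 != 0]).
  apply/seteqP; split=> g /=.
    move=> gy; apply: contrapT => H; apply: gy; rewrite -[RHS]reprK.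
    apply/esym/pi_borel_subP => i j ji; rewrite GLmxM GLmxV.
    apply/eqP; apply: contrapT => /negP ne; apply: H; exists (i, j) => //.
  move=> [[i j] /= ji [_ ne]] gy; move: ne; rewrite -[invmx _ *m _]/(GLmx (h^-1 * g)%g).
  have : \pi_Y h = \pi_Y g by rewrite gy reprK.
  by move/pi_borel_subP => ->; rewrite // eqxx.
apply: bigcup_open => p _; apply: open_nonzero => //.
exact: (regular_mxM oT (@regular_mx_cst _ _ _ _ _ (invmx (GLmx h)) oT)
  (@regular_mx_comp _ _ _ _ _ _ (@morphism_on_val _ _ _))).
Qed.

Definition torus_coord (x : X) : 'M[k]_n.+1 := ratio_mx (hyperplane P (repr x)).

Lemma torus_coord_pi g : torus_coord (\pi_X g) = ratio_mx (hyperplane P g).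
Proof.
rewrite /torus_coord; have [b bB ->] := repr_borel g.
have c0 : (last_diag P b)^-1 != 0 by rewrite invr_eq0; exact: borel_diag_neq0.
rewrite hyperplane_borel //; apply/matrixP => i j.
by rewrite !mxE -mulf_div divff // mul1r.
Qed.

Lemma morphism_on_torus_coord : morphism_on Xgen (torus_coord : X -> affine_space k n.+1 n.+1).
Proof.
apply: morphism_on_quotient.
apply: (@eq_morphism_on _ _ _ _
  ((fun g => ratio_mx (hyperplane P g)) : GL k n.+1 -> affine_space k n.+1 n.+1)).
  by move=> g _ /=; rewrite torus_coord_pi.
have o : open (\pi_X @^-1` Xgen) := open_Xgen.
have oT : open (setT : set (GL k n.+1)) by exact: openT.
have rh j : regular (\pi_X @^-1` Xgen) (fun g => hyperplane P g 0 j).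
  exact: sub_regular_on (regular_hyperplane P 0 j).
apply: morphism_on_regular_mx => // i j.
apply: (@eq_regular _ _ _ (fun g => hyperplane P g 0 i * (hyperplane P g 0 j)^-1)) => //.
  by move=> g _; rewrite [RHS]mxE.
apply: regularM => //; apply: regular_inv => // g /(generic_pi_repr g).1; exact.
Qed.

(** * Affine charts *)

Section Chart.
Variable g0 : GL k n.

Let A (h : GL k n) := GLmx (g0^-1 * h)%g.

Let regA : regular_mx setT A.
Proof.
have oT : open (setT : set (GL k n)) by exact: openT.
exact: (regular_mxM oT (@regular_mx_cst _ _ _ _ _ (invmx (GLmx g0)) oT)
  (@regular_mx_comp _ _ _ _ _ _ (@morphism_on_val _ _ _))).
Qed.

Lemma repr_borel_sub (h : GL k n) :
  exists2 b, b \in borel_sub P & repr (\pi_Y h) = (h * b)%g.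
Proof.
exists (h^-1 * repr (\pi_Y h))%g; last by rewrite mulVKg.
by apply/borel_subP/(iffLR (pi_borel_subP P _ _)); rewrite reprK.
Qed.

Let A_borel h b : A (h * b)%g = A h *m GLmx b.
Proof. by rewrite /A mulgA. Qed.

(** The translate by g0 of the open set of flags in general position with the
    opposite flag; the lower unitriangular factor identifies it with an affine
    space. *)
Definition big_cell : set Y := [set y | lu_minors (A (repr y)) != 0].

Lemma big_cell_pi h : big_cell (\pi_Y h) <-> lu_minors (A h) != 0.
Proof.
have [b /borel_subP tb bE] := repr_borel_sub h.
by rewrite /big_cell /= bE A_borel lu_minorsM // GLmx_unit.
Qed.

Let pi_big_cell : \pi_Y @^-1` big_cell = setT `&` [set h | lu_minors (A h) != 0].
Proof. by apply/seteqP; split=> h /=; rewrite big_cell_pi // => -[]. Qed.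

Lemma open_big_cell : open big_cell.
Proof.
change (open (\pi_Y @^-1` big_cell)); rewrite pi_big_cell.
have oT : open (setT : set (GL k n)) by exact: openT.
by apply: open_nonzero => //; exact: regular_lu_minors.
Qed.

Definition cell_coord (y : Y) : affine_space k n n := lu_left (A (repr y)).

Lemma cell_coord_pi h : big_cell (\pi_Y h) -> cell_coord (\pi_Y h) = lu_left (A h).
Proof.
have [b /borel_subP tb bE] := repr_borel_sub h.
move/big_cell_pi => hV.
by rewrite /cell_coord bE A_borel lu_left_mul_upper ?GLmx_unit.
Qed.

Lemma morphism_on_cell_coord : morphism_on big_cell cell_coord.
Proof.
apply: morphism_on_quotient.
apply: (@eq_morphism_on _ _ _ _ (fun h => lu_left (A h) : affine_space k n n)).
  by move=> h hV /=; rewrite cell_coord_pi.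
have o := open_big_cell.
apply: morphism_on_regular_mx => //.
apply: regular_lu_left => [||h /big_cell_pi] //.
move=> i j; apply: sub_regular_on (regA i j) => //; exact: openT.
Qed.

Lemma cell_coord_unitrig y : big_cell y -> lower_unitrig (cell_coord y).
Proof. exact: lu_left_unitrig. Qed.

Definition cell_point (L : 'M[k]_n) : GL k n := GL_of_mx (GLmx g0 *m L).

Lemma A_cell_point L : lower_unitrig L -> A (cell_point L) = L.
Proof.
move=> uL; rewrite /A GLmxM GLmxV GL_of_mxK ?mulKmx ?GLmx_unit //.
by rewrite unitmx_mul GLmx_unit unitmxE det_lower_unitrig ?unitr1.
Qed.

Lemma cell_point_big_cell L : lower_unitrig L -> big_cell (\pi_Y (cell_point L)).
Proof. by move=> uL; apply/big_cell_pi; rewrite A_cell_point // lu_minors_unitrig. Qed.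

Lemma cell_pointK L : lower_unitrig L -> cell_coord (\pi_Y (cell_point L)) = L.
Proof.
move=> uL; rewrite cell_coord_pi; last exact: cell_point_big_cell.
by rewrite A_cell_point // lu_left_id.
Qed.

Lemma cell_coordK y : big_cell y -> \pi_Y (cell_point (cell_coord y)) = y.
Proof.
move=> yV; rewrite -[RHS]reprK; apply/esym/pi_borel_subP.
have uR := lu_right_unit yV.
rewrite GLmxM GL_of_mxK; last first.
  rewrite unitmx_mul GLmx_unit unitmxE det_lower_unitrig ?unitr1 //.
  exact: cell_coord_unitrig.
have E : GLmx g0 *m A (repr y) = GLmx (repr y).
  by rewrite -[RHS](congr1 (@GLmx k n) (mulVKg g0 (repr y))).
rewrite /cell_coord /lu_left.
rewrite (mulmxA (GLmx g0)) E GLmxV mulKmx ?GLmx_unit //.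
exact: lu_right_upper.
Qed.

Lemma closed_lower_unitrig p q r (f : affine_space k p q -> 'M[k]_r) :
  regular_mx setT f -> closed [set B | lower_unitrig (f B)].
Proof.
have oT : open (setT : set (affine_space k p q)) by exact: openT.
move=> rf; pose I := {ij : 'I_r * 'I_r | (ij.1 <= ij.2)%N}.
have -> : [set B | lower_unitrig (f B)] = [set B | forall ij : I,
    f B (val ij).1 (val ij).2 = ((val ij).1 == (val ij).2)%:R].
  apply/seteqP; split=> B /= H; first by move=> [[i j] /= ij]; exact: H.
  by move=> i j ij; exact: (H (exist _ (i, j) ij)).
by apply: closed_eq => -[[i j] ij]; [exact: rf | exact: regular_cst].
Qed.

Lemma big_cell_affine : affine big_cell.
Proof.
pose Z : set (affine_space k n n) := [set L | lower_unitrig L].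
have GZ (L : Z) : \pi_Y (cell_point (val L)) \in big_cell.
  by apply/mem_set/cell_point_big_cell; exact: set_mem (valP L).
pose F (y : set_type big_cell) := cell_coord (val y).
pose G (L : Z) : set_type big_cell :=
  exist _ (\pi_Y (cell_point (val L))) (GZ L).
apply: (@affine_embedding k (set_type big_cell) _ _ Z F G).
- exact: (@closed_lower_unitrig n n n (fun L => L)
    (fun i j => @regular_coord k n n i j)).
- by move=> y; apply: cell_coord_unitrig; exact: set_mem (valP y).
- apply/morphism_onT; have := morphism_on_comp (@morphism_on_val _ _ big_cell)
    morphism_on_cell_coord.
  rewrite setTI; congr morphism_on; apply/seteqP; split=> // y _.
  exact: set_mem (valP y).
- apply/morphism_onT/morphism_on_sub.
  have oT : open (setT : set Z) by exact: openT.
  have mG : morphism_on setT (fun L : Z => cell_point (val L)).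
    apply: morphism_on_GL => //.
    have := regular_mxM oT (@regular_mx_cst _ _ _ _ _ (GLmx g0) oT)
      (@regular_mx_comp _ _ _ _ _ _ (@morphism_on_val _ _ Z)).
    move=> H i j; apply: (eq_regular oT _ (H i j)) => L _.
    rewrite GL_of_mxK // unitmx_mul GLmx_unit unitmxE det_lower_unitrig ?unitr1 //.
    exact: set_mem (valP L).
  have := morphism_on_comp mG (@morphism_on_pi _ _ (lcosets (borel_sub P))).
  by rewrite preimage_setT setIT.
- move=> y L LE; apply: val_inj => /=; rewrite LE cell_coordK //.
  exact: set_mem (valP y).
- by move=> L; apply: cell_pointK; exact: set_mem (valP L).
Qed.

Section TotalChart.
Variables (Q : 'M[k]_n.+1) (L : 'M[k]_n.+1).
Hypotheses (cQ : cocycle_mx Q) (uL : lower_unitrig L).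

(** The flag whose hyperplane has equation prescribed by Q and whose slice is
    prescribed by L.  The row of Q of index ord_max is the inverse of its column
    of the same index, which saves taking inverses. *)
Definition total_point : GL k n.+1 :=
  (of_basis_mx P (diag_mx (row ord_max Q)) *
   slice_section P D (cell_point (upper_left L)))%g.

Let diag_unit : diag_mx (row ord_max Q) \in unitmx.
Proof.
rewrite unitmxE det_diag unitfE; apply/prodf_neq0 => j _.
by rewrite mxE; exact: cocycle_mx_neq0.
Qed.

Let hE : basis_mx P (of_basis_mx P (diag_mx (row ord_max Q))) =
  diag_mx (row ord_max Q).
Proof. exact: of_basis_mxK. Qed.

Let uL' : lower_unitrig (upper_left L).
Proof. exact: lower_unitrig_upper_left. Qed.

Lemma total_point_generic : generic P total_point.
Proof. by apply: (generic_diag _ hE).2; exact: generic_section. Qed.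

Lemma total_point_slice : slice P D total_point = cell_point (upper_left L).
Proof. by rewrite /total_point (slice_diag _ _ hE) sliceK. Qed.

Lemma total_point_ratio : ratio_mx (hyperplane P total_point) = Q.
Proof.
rewrite (hyperplane_diag _ hE) hyperplane_section //; apply/matrixP => i j.
have [Q1 QM] := cQ; have Q0 a b := @cocycle_mx_neq0 _ _ _ a b cQ.
rewrite !mxE !div1r invrK -(QM ord_max i j) mulrA mulVf ?mul1r //.
Qed.

Lemma total_point_mx : basis_mx P total_point = diag_mx (row ord_max Q) *m
  (D *m embed_mx (GLmx g0 *m upper_left L)).
Proof.
rewrite basis_mxM hE slice_sectionE // GL_of_mxK //.
by rewrite unitmx_mul GLmx_unit unitmxE det_lower_unitrig ?unitr1.
Qed.

End TotalChart.

Lemma total_pointK x g : x = \pi_X g -> generic P g ->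
  big_cell (\pi_Y (slice P D g)) ->
  \pi_X (total_point (torus_coord x) (embed_mx (cell_coord (\pi_Y (slice P D g)))))
    = x.
Proof.
move=> -> gg gV; have uh := hyperplane_mx_unit gg.
have E := section_slice D_unit D_sum gg (of_basis_mxK P uh).
rewrite /total_point -translate_pi upper_left_embed.
rewrite (slice_section_pi (cell_coordK gV)) -E translate_pi torus_coord_pi.
apply/esym/pi_borelP.
have uQ : diag_mx (row ord_max (ratio_mx (hyperplane P g))) \in unitmx.
  rewrite unitmxE det_diag unitfE; apply/prodf_neq0 => j _.
  by rewrite mxE; apply: cocycle_mx_neq0; exact: cocycle_ratio_mx.
suff -> : basis_mx P (g^-1 * (of_basis_mx P (diag_mx (row ord_max
      (ratio_mx (hyperplane P g)))) * (of_basis_mx P (diag_mx (hyperplane P g)) * g)))%g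
    = (hyperplane P g 0 ord_max)%:M.
  by move=> i j ji; rewrite mxE -val_eqE gtn_eqF.
rewrite !basis_mxM !of_basis_mxK // [X in _ *m X]mulmxA mulmx_diag.
rewrite (_ : diag_mx _ = (hyperplane P g 0 ord_max)%:M).
  by rewrite mul_scalar_mx -scalemxAr basis_mxV mulVmx ?basis_mx_unit // scalemx1.
move: (hyperplane P g) (gg : forall j, hyperplane P g 0 j != 0) => v v0.
by rewrite -diag_const_mx; congr diag_mx; apply/rowP => j; rewrite !mxE divfK.
Qed.

(** Over a big cell the semistable locus is the product of the cell by the torus
    modulo scalars; the pair of coordinates embeds it as a closed set of pairs
    of matrices. *)
Lemma quotient_map_chart_affine : affine (quotient_map @^-1` big_cell).
Proof.
pose W : set Xss := quotient_map @^-1` big_cell.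
pose Z : set (affine_space k n.+1 (n.+1 + n.+1)) :=
  [set B | cocycle_mx (lsubmx B)] `&`
  ([set B | lower_unitrig (rsubmx B)] `&` [set B | last_row_unit (rsubmx B)]).
pose pt (z : Z) := total_point (lsubmx (val z)) (rsubmx (val z)).
have Zc (z : Z) : cocycle_mx (lsubmx (val z)) by have [] := set_mem (valP z).
have Zu (z : Z) : lower_unitrig (rsubmx (val z)) by have [_ []] := set_mem (valP z).
have Zl (z : Z) : last_row_unit (rsubmx (val z)) by have [_ []] := set_mem (valP z).
have ss (z : Z) : \pi_X (pt z) \in Xss.
  by apply/mem_set/semistableP; exact: total_point_generic.
pose G1 (z : Z) : Xss := exist _ (\pi_X (pt z)) (ss z).
have G1q z : quotient_map (G1 z) = \pi_Y (cell_point (upper_left (rsubmx (val z)))).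
  by rewrite (@quotient_mapE (G1 z) (pt z)) // total_point_slice.
have uul (z : Z) : lower_unitrig (upper_left (rsubmx (val z))).
  exact: lower_unitrig_upper_left.
have GW (z : Z) : G1 z \in W.
  by apply/mem_set; rewrite /W /= G1q; exact: cell_point_big_cell.
pose G (z : Z) : set_type W := exist _ (G1 z) (GW z).
pose F (w : set_type W) : affine_space k n.+1 (n.+1 + n.+1) :=
  row_mx (torus_coord (val (val w))) (embed_mx (cell_coord (quotient_map (val w)))).
have repE (w : set_type W) : exists2 g, val (val w) = \pi_X g & generic P g.
  exists (repr (val (val w))); first by rewrite reprK.
  exact: generic_repr.
have Wq (w : set_type W) : big_cell (quotient_map (val w)) by exact: set_mem (valP w).
have rsub := fun i j => @regular_coord k n.+1 (n.+1 + n.+1) i j.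
have oA : open (setT : set (affine_space k n.+1 (n.+1 + n.+1))) by exact: openT.
have rl : regular_mx setT
    (fun B : affine_space k n.+1 (n.+1 + n.+1) => lsubmx B).
  by move=> i j; apply: (eq_regular oA _ (rsub i (lshift _ j))) => B _; rewrite mxE.
have rr : regular_mx setT
    (fun B : affine_space k n.+1 (n.+1 + n.+1) => rsubmx B).
  by move=> i j; apply: (eq_regular oA _ (rsub i (rshift _ j))) => B _; rewrite mxE.
apply: (@affine_embedding k (set_type W) _ _ Z F G).
- apply: closedI; last apply: closedI; last first.
  + have -> : [set B : affine_space k n.+1 (n.+1 + n.+1) | last_row_unit (rsubmx B)] =
        [set B | forall j, rsubmx B ord_max j = (j == ord_max)%:R] by [].
    by apply: closed_eq => j; [exact: rr | exact: regular_cst].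
  + exact: closed_lower_unitrig.
  + have -> : [set B : affine_space k n.+1 (n.+1 + n.+1) | cocycle_mx (lsubmx B)] =
        [set B | forall i, lsubmx B i i = 1] `&`
        [set B | forall t : 'I_n.+1 * 'I_n.+1 * 'I_n.+1,
          lsubmx B t.1.1 t.1.2 * lsubmx B t.1.2 t.2 = lsubmx B t.1.1 t.2].
      apply/seteqP; split=> B [H1 H]; split; [exact: H1| |exact: H1|].
        by move=> [[i j] l]; exact: H.
      by move=> i j l; exact: (H (i, j, l)).
    apply: closedI.
      by apply: closed_eq => i; [exact: rl | exact: regular_cst].
    apply: closed_eq => -[[i j] l]; last exact: rl.
    by apply: regularM => //; exact: rl.
- move=> w; have [g xg gg] := repE w; split; last split.
  + by rewrite /= row_mxKl xg torus_coord_pi; exact: cocycle_ratio_mx.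
  + rewrite /= row_mxKr; apply: lower_unitrig_embed; apply: cell_coord_unitrig.
    exact: Wq.
  + by rewrite /= row_mxKr; exact: embed_mx_last_row.
- have oW : open (setT : set (set_type W)) by exact: openT.
  have mW := morphism_on_comp (@morphism_on_val _ _ W) (@morphism_on_val _ _ Xss).
  apply/morphism_onT/morphism_on_regular_mx => //; apply: regular_row_mx => //.
    apply: (@regular_mx_comp _ (set_type W)).
    have := morphism_on_comp mW morphism_on_torus_coord.
    congr morphism_on; apply/seteqP; split=> // w _; split=> //.
    exact: generic_repr.
  apply: regular_embed_mx => //; apply: (@regular_mx_comp _ (set_type W)).
  have := morphism_on_comp (morphism_on_comp (@morphism_on_val _ _ W)
    ((morphism_onT _).2 quotient_map_morphism)) morphism_on_cell_coord.
  by congr morphism_on; apply/seteqP; split=> // w _; split=> //; exact: Wq.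
- have oZ : open (setT : set (set_type Z)) by exact: openT.
  have rval (f : affine_space k n.+1 (n.+1 + n.+1) -> 'M[k]_n.+1) :
      regular_mx setT f -> regular_mx setT (fun z : Z => f (val z)).
    move=> rf i j; have := morphism_on_regular (@morphism_on_val _ _ Z) oA (rf i j).
    by rewrite preimage_setT setIT.
  have mpt : morphism_on setT pt.
    apply: morphism_on_GL => //.
    have rc (B : 'M[k]_n.+1) := @regular_mx_cst _ _ setT _ _ B oZ.
    have rd : regular_mx setT (fun z : Z => diag_mx (row ord_max (lsubmx (val z)))).
      move=> i j; apply: (eq_regular oZ _ (regularM _ _ _ oZ
        (rval _ rl ord_max i) (regular_cst _ (i == j)%:R oZ))) => z _.
      by rewrite !mxE mulr_natr.
    have ru : regular_mx setT (fun z : Z => GLmx g0 *m upper_left (rsubmx (val z))).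
      apply: regular_mxM => //; first exact: regular_mx_cst.
      by apply: regular_upper_left => //; exact: rval.
    have H := regular_mxM oZ (rc (GLmx P)) (regular_mxM oZ (regular_mxM oZ rd
      (regular_mxM oZ (rc D) (regular_embed_mx oZ ru))) (rc (invmx (GLmx P)))).
    move=> i j; apply: (eq_regular oZ _ (H i j)) => z _.
    by rewrite [in RHS](GLmx_basis_mx P) total_point_mx.
  apply/morphism_onT/morphism_on_sub/morphism_on_sub.
  have := morphism_on_comp mpt (@morphism_on_pi _ _ (lcosets (borel P))).
  by rewrite preimage_setT setIT.
- move=> w z zF; have [g xg gg] := repE w; apply/val_inj/val_inj => /=.
  have := Wq w; have qE := quotient_mapE xg; rewrite qE => gV.
  rewrite /pt zF /F row_mxKl row_mxKr qE.
  exact: total_pointK.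
- move=> z; rewrite /F /= G1q cell_pointK // torus_coord_pi total_point_ratio //.
  by rewrite upper_leftK // hsubmxK.
Qed.

End Chart.

Lemma quotient_map_affine : affine_morphism quotient_map.
Proof.
move=> y; exists (big_cell (repr y)); split.
- exact: open_big_cell.
- rewrite -[X in big_cell _ X]reprK; apply/big_cell_pi; rewrite mulVg GLmx1.
  apply: lu_minors_unitrig; by move=> i j _; rewrite mxE.
- exact: big_cell_affine.
- exact: quotient_map_chart_affine.
Qed.

End QuotientMap.

(** * The normaliser of the torus and the Cartan subalgebra *)

Section Monomial.
Variables (k : closedFieldType) (n : nat) (P : GL k n.+1).

Lemma exists_non_involution : exists2 a : k, a != 0 & a != a^-1.
Proof.
have R0 : 'X * ('X^2 - 1) != 0 :> {poly k}.
  rewrite mulf_neq0 ?polyX_eq0 //; apply/eqP => /(congr1 (fun r : {poly k} => r`_2)).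
  by rewrite coefB coefXn coef1 coef0 subr0 => /eqP; rewrite oner_eq0.
have [a] := closed_nonrootP _ R0.
rewrite /root !hornerE mulf_eq0 negb_or => /andP[a0 a1]; exists a => //.
apply: contraNneq a1 => aV; rewrite ?hornerXn expr2 {2}aV divff //.
by rewrite subrr.
Qed.

(** If column j of nu had nonzero entries in rows i and i', conjugating a
    diagonal matrix by nu could be diagonal only if its entries of index i and
    i' agreed. *)
Lemma normaliser_column nu i i' j : normaliser P nu ->
  basis_mx P nu i j != 0 -> basis_mx P nu i' j != 0 -> i = i'.
Proof.
move=> [_ nuT] ij i'j; apply/eqP; apply: contraT => ii'.
(* With entries a and a^-1 at i and i', and 1 elsewhere, the determinant is
   1. *)
have [a a0 aV] := exists_non_involution.
pose d := \row_l if l == i then a else if l == i' then a^-1 else 1.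
have d1 : \prod_l d 0 l = 1.
  rewrite (bigD1 i) // (bigD1 i') 1?eq_sym //= !mxE !eqxx big1 => [|l /andP[li li']].
    by rewrite eq_sym (negPf ii') mulr1 divff.
  by rewrite mxE (negPf li) (negPf li').
have ud : diag_mx d \in unitmx by rewrite unitmxE det_diag d1 unitr1.
have := nuT (of_basis_mx P (diag_mx d)); rewrite diag_torus // => /andP[/diag_mxP[e eE] _].
have E : diag_mx d *m basis_mx P nu = basis_mx P nu *m diag_mx e.
  rewrite -eE -/(basis_mx P _) -basis_mxM conjgE mulVKg basis_mxM.
  by rewrite of_basis_mxK.
have key l : basis_mx P nu l j != 0 -> d 0 l = e 0 j.
  move=> lj; apply: (mulIf lj); rewrite mulrC [RHS]mulrC.
  have /matrixP/(_ l j) := E; rewrite mul_diag_mx mul_mx_diag.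
  by rewrite [LHS]mxE [RHS]mxE mulrC => ->.
have := key i ij; rewrite -(key i' i'j) !mxE eqxx eq_sym (negPf ii') eqxx => aa.
by rewrite -aa eqxx in aV.
Qed.

Lemma normaliser_monomial nu : normaliser P nu ->
  exists s : 'S_n.+1, exists d, basis_mx P nu = perm_mx s *m diag_mx d.
Proof.
move=> Nnu; pose S := basis_mx P nu; have uS : S \in unitmx := basis_mx_unit P nu.
have ex j : exists i, S i j != 0.
  apply/existsP; apply: contraT; rewrite negb_exists => /forallP S0.
  have /matrixP/(_ j j) := mulVmx uS; rewrite [RHS]mxE eqxx mxE big1 => [|i _].
    by move/eqP; rewrite eq_sym oner_eq0.
  by have := S0 i; rewrite negbK => /eqP ->; rewrite mulr0.
have [f fP] := choice ex.
have SE i j : S i j = if i == f j then S (f j) j else 0.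
  case: eqP => [->//|ij]; apply/eqP; apply: contraT => Sij.
  by case: ij; apply: normaliser_column Nnu Sij (fP j).
have invS i j : invmx S i (f j) * S (f j) j = (i == j)%:R.
  have /matrixP/(_ i j) := mulVmx uS; rewrite [RHS]mxE => <-.
  rewrite [RHS]mxE (bigD1 (f j)) //= big1 ?addr0 // => l lj.
  by rewrite SE (negPf lj) mulr0.
have injf : injective f.
  move=> j j' jj'; apply/eqP; apply: contraT => ne.
  have := invS j' j; rewrite eq_sym (negPf ne) => /eqP.
  rewrite mulf_eq0 (negPf (fP j)) orbF jj' => /eqP Z.
  by have := invS j' j'; rewrite Z mul0r eqxx => /eqP; rewrite eq_sym oner_eq0.
exists (perm injf)^-1%g, (\row_j S (f j) j); apply/matrixP => i j.
have fE : ((perm injf)^-1%g i == j) = (i == f j).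
  by apply/eqP/eqP => [<-|->]; rewrite -(permE injf) ?permKV ?permK.
rewrite -/S SE mul_mx_diag !mxE fE.
by case: eqP => _; rewrite ?mul1r ?mul0r.
Qed.

Lemma diag_perm_mx (s : 'S_n.+1) (v : 'rV[k]_n.+1) :
  diag_mx v *m perm_mx s = perm_mx s *m diag_mx (v *m perm_mx s).
Proof.
apply/matrixP => i j; rewrite mul_diag_mx mul_mx_diag.
rewrite -[s in v *m perm_mx s]invgK -col_permE !mxE.
by case: eqP => [<-|]; rewrite ?permK ?mulr1 ?mul1r // mulr0 mul0r.
Qed.

Variables (nu : GL k n.+1) (s : 'S_n.+1) (d : 'rV[k]_n.+1).
Hypothesis nuE : basis_mx P nu = perm_mx s *m diag_mx d.

Let hyperplane_nu g :
  hyperplane P (nu * g)%g *m perm_mx s *m diag_mx d = hyperplane P g.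
Proof.
rewrite -mulmxA -nuE /hyperplane -row_mul -!basis_mxV -basis_mxM.
by rewrite invgM -mulgA mulVg mulg1.
Qed.

Lemma generic_monomial g : generic P g -> generic P (nu * g)%g.
Proof.
move=> gg i; have := gg (s i); rewrite -(hyperplane_nu g) mul_mx_diag mxE.
rewrite -[s in _ *m perm_mx s]invgK -col_permE [X in X * _]mxE permK.
by rewrite mulf_eq0 negb_or => /andP[].
Qed.

(** The scaling part of nu is absorbed as for diagonal matrices; only the
    permutation survives. *)
Lemma balanced_monomial g :
  balanced P (nu * g)%g = perm_mx s *m balanced P g.
Proof.
have E : diag_mx (hyperplane P (nu * g)%g *m perm_mx s) *m diag_mx d =
    diag_mx (hyperplane P g).
  rewrite -(hyperplane_nu g) mulmx_diag mul_mx_diag; congr diag_mx.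
  by apply/rowP => j; rewrite [LHS]mxE [RHS]mxE.
rewrite /balanced basis_mxM nuE; move: (basis_mx P g) => M.
by rewrite !mulmxA diag_perm_mx -!mulmxA (mulmxA (diag_mx _) (diag_mx _)) E.
Qed.

Lemma monomial_conj_diag (v : 'rV[k]_n.+1) :
  basis_mx P nu *m diag_mx v *m basis_mx P nu^-1%g =
  diag_mx (v *m perm_mx s^-1%g).
Proof.
rewrite basis_mxV; apply: (canLR (mulmxK (basis_mx_unit P nu))).
rewrite nuE mulmxA diag_perm_mx -[v *m _ *m _]mulmxA -perm_mxM mulVg perm_mx1 mulmx1.
rewrite -!mulmxA; congr (_ *m _); rewrite !mulmx_diag.
by congr diag_mx; apply/rowP => j; rewrite !mxE mulrC.
Qed.

End Monomial.

Section Cartan.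
Variables (k : fieldType) (n : nat) (P : GL k n.+1).

Definition toral_mx (d : 'rV[k]_n.+1) : 'M[k]_n.+1 :=
  GLmx P *m diag_mx d *m GLmx P^-1%g.

Lemma toral_mx_is_linear : linear toral_mx.
Proof.
by move=> c d e; rewrite /toral_mx linearP /= mulmxDr mulmxDl -scalemxAr -scalemxAl.
Qed.
HB.instance Definition _ := GRing.isLinear.Build k 'rV[k]_n.+1 'M[k]_n.+1 _ toral_mx
  toral_mx_is_linear.

Definition trace_form (X : 'M[k]_n.+1) : k^o := \tr X.

Lemma trace_form_is_linear : linear trace_form.
Proof. by move=> c X Y; rewrite /trace_form mxtraceD mxtraceZ. Qed.
HB.instance Definition _ := GRing.isLinear.Build k 'M[k]_n.+1 k^o _ trace_form
  trace_form_is_linear.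

Lemma toral_mx_inj : injective toral_mx.
Proof.
move=> d e; rewrite /toral_mx GLmxV => /(can_inj (mulmxKV (GLmx_unit P))) H.
have := can_inj (mulKmx (GLmx_unit P)) H.
by move=> /matrixP E; apply/rowP => j; have := E j j; rewrite !mxE eqxx !mulr1n.
Qed.

Lemma mxtrace_toral d : \tr (toral_mx d) = \sum_j d 0 j.
Proof.
by rewrite /toral_mx mxtrace_mulC mulmxA GLmxV mulVmx ?GLmx_unit // mul1mx mxtrace_diag.
Qed.

Lemma mem_cartan X : reflect (exists2 d, X = toral_mx d & \sum_j d 0 j = 0)
  (X \in cartan_subalgebra P).
Proof.
rewrite /cartan_subalgebra memv_cap memv_ker.
rewrite (_ : linfun _ X = (\tr X : k^o)); last exact: (lfunE trace_form).
apply: (iffP andP) => [[/memv_imgP[d _ XE] /eqP tX]|[d -> d0]].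
  have E : X = toral_mx d by rewrite XE; exact: (lfunE toral_mx).
  by exists d => //; rewrite -mxtrace_toral -E.
split; last by rewrite mxtrace_toral d0.
apply/memv_imgP; exists d; first exact: memvf.
by apply/esym; exact: (lfunE toral_mx).
Qed.

(** Rank and nullity for the trace on the diagonal matrices, where it is onto in
    every characteristic. *)
Lemma dim_cartan : \dim (cartan_subalgebra P) = n.
Proof.
rewrite /cartan_subalgebra; set f := linfun _; set t := linfun _.
have fE d : f d = toral_mx d by exact: (lfunE toral_mx).
have tE X : t X = \tr X by exact: (lfunE trace_form).
have := limg_ker_dim t (limg f).
have -> : \dim (limg f) = n.+1.
  rewrite limg_dim_eq; first by rewrite dimvf /dim /= mul1n.
  apply/eqP; rewrite -subv0; apply/subvP => d; rewrite memv_cap memv_ker fE.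
  move=> /andP[_ /eqP E]; rewrite memv0; apply/eqP/toral_mx_inj.
  by rewrite E linear0.
have -> : \dim (t @: limg f) = 1%N.
  apply/eqP; rewrite eqn_leq; apply/andP; split.
    by apply: leq_trans (dimvS (subvf _)) _; rewrite dimvf.
  rewrite lt0n dimv_eq0; apply/eqP => E.
  have : t (f (delta_mx 0 0)) \in (t @: limg f)%VS by rewrite !memv_img ?memvf.
  rewrite E memv0 tE fE mxtrace_toral (bigD1 0) //= big1 => [|j j0].
    by rewrite mxE !eqxx addr0 oner_eq0.
  by rewrite mxE (negPf j0) andbF.
by rewrite addn1 => -[].
Qed.

Lemma exists_cartan_basis :
  exists b : n.-tuple 'M[k]_n.+1, basis_of (cartan_subalgebra P) b.
Proof.
exists (tcast dim_cartan (vbasis (cartan_subalgebra P))).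
by rewrite val_tcast; exact: vbasisP.
Qed.

End Cartan.

(** * The Weyl group acts through its reflection representation *)

Section Frame.
Variables (k : closedFieldType) (n : nat) (P : GL k n.+1).

Lemma conj_toral nu (s : 'S_n.+1) e d : basis_mx P nu = perm_mx s *m diag_mx e ->
  GLmx nu *m toral_mx P d *m GLmx nu^-1%g = toral_mx P (d *m perm_mx s^-1%g).
Proof.
move=> nuE; rewrite {2}/toral_mx -(monomial_conj_diag nuE d).
rewrite (GLmx_basis_mx P nu) (GLmx_basis_mx P nu^-1%g) /toral_mx.
move: (basis_mx P nu) (basis_mx P nu^-1%g) => M N.
rewrite (GLmxV P) -!mulmxA; congr (_ *m (_ *m _)).
rewrite mulKmx ?GLmx_unit //; congr (_ *m _).
by rewrite mulKmx ?GLmx_unit.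
Qed.

Lemma conj_toral_torus t d : t \in torus P ->
  GLmx t *m toral_mx P d *m GLmx t^-1%g = toral_mx P d.
Proof.
move=> /andP[/diag_mxP[e tE] _].
have tE' : basis_mx P t = perm_mx 1 *m diag_mx e by rewrite perm_mx1 mul1mx.
by rewrite (conj_toral _ tE') invg1 perm_mx1 mulmx1.
Qed.

Variable b : n.-tuple 'M[k]_n.+1.
Hypothesis b_basis : basis_of (cartan_subalgebra P) b.

Let diagonal j : exists d, b`_j = toral_mx P d /\ \sum_i d 0 i = 0.
Proof.
have [jn|nj] := ltnP j n; last first.
  exists 0; rewrite nth_default ?size_tuple // linear0; split=> //.
  by apply: big1 => i _; rewrite mxE.
have : b`_j \in cartan_subalgebra P.
  by apply: (basis_mem b_basis); rewrite mem_nth // size_tuple.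
by move=> /mem_cartan[d -> d0]; exists d.
Qed.

Definition frame_row (j : nat) : 'rV[k]_n.+1 := projT1 (cid (diagonal j)).

Let frame_rowE j : b`_j = toral_mx P (frame_row j).
Proof. by rewrite /frame_row; case: cid => d []. Qed.

Let frame_row_sum j : \sum_i frame_row j 0 i = 0.
Proof. by rewrite /frame_row; case: cid => d []. Qed.

(** The first n columns are the diagonals of the given basis of the Cartan
    subalgebra; the last one, a coordinate vector, completes them to a frame
    with the sum of the coordinates as last coordinate. *)
Definition frame_mx : 'M[k]_n.+1 := \matrix_(i, j)
  if unlift ord_max j is Some l then frame_row l 0 i else (i == ord_max)%:R.

Lemma frame_sum : const_mx 1 *m frame_mx = delta_mx 0 ord_max :> 'rV_n.+1.
Proof.
apply/rowP => j; rewrite !mxE.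
under eq_bigr do rewrite !mxE mul1r.
case: unliftP => [l ->|->].
  by rewrite frame_row_sum eq_sym (negPf (neq_lift _ _)).
rewrite eqxx (bigD1 ord_max) //= eqxx big1 ?addr0 // => i /negPf.
by move=> ->.
Qed.

Lemma frame_unit : frame_mx \in unitmx.
Proof.
rewrite -unitmx_tr -row_free_unit; apply: inj_row_free => v vF.
have vm : v 0 ord_max = 0.
  have /rowP/(_ 0) := congr1 (mulmx^~ (const_mx 1 : 'M_(n.+1, 1))) vF.
  rewrite mul0mx [RHS]mxE -mulmxA -[const_mx 1]trmxK -trmx_mul trmx_const frame_sum.
  by rewrite trmx_delta -colE mxE.
have V0 : \sum_(j < n) v 0 (lift ord_max j) *: b`_j = 0.
  transitivity (toral_mx P (\sum_(j < n) v 0 (lift ord_max j) *: frame_row j)).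
    by rewrite linear_sum; apply: eq_bigr => j _; rewrite linearZ frame_rowE.
  rewrite -[RHS](linear0 (toral_mx P)) -[in RHS]vF; congr toral_mx; apply/rowP => i.
  rewrite summxE mxE (bigD1_ord ord_max) //= vm mul0r add0r.
  by apply: eq_bigr => j _; rewrite !mxE liftK.
have /freeP/(_ _ V0) v0 := basis_free b_basis.
apply/rowP => j; rewrite [RHS]mxE.
by case: (unliftP ord_max j) => [l ->|->].
Qed.

Section Conjugation.
Variables (nu : GL k n.+1) (s : 'S_n.+1) (e : 'rV[k]_n.+1) (R : 'M[k]_n).
Hypothesis nuE : basis_mx P nu = perm_mx s *m diag_mx e.
Hypothesis conjE : forall j : 'I_n, GLmx nu *m b`_j *m GLmx nu^-1%g =
  \sum_(i < n) R i j *: b`_i.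

Let C := invmx frame_mx *m (perm_mx s *m frame_mx).

Let C_last_row : last_row_unit C.
Proof.
have invF : row ord_max (invmx frame_mx) = const_mx 1.
  by rewrite rowE -frame_sum mulmxK ?frame_unit.
have sum1 : const_mx 1 *m perm_mx s = const_mx 1 :> 'rV[k]_n.+1.
  rewrite -[s]invgK -col_permE; apply/rowP => j; by rewrite !mxE.
move=> j; have : row ord_max C = delta_mx 0 ord_max.
  by rewrite row_mul invF mulmxA sum1 frame_sum.
by move=> /rowP/(_ j); rewrite [LHS]mxE => ->; rewrite mxE eqxx.
Qed.

(** The diagonals of the basis of the Cartan subalgebra are permuted under
    conjugation by nu: this says that the permutation matrix, written in the
    frame, has the matrix R of the conjugation as its leading block. *)
Lemma frame_conj_upper_left : upper_left C = R.
Proof.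
have key (j : 'I_n) : frame_row j *m perm_mx s^-1%g = \sum_(i < n) R i j *: frame_row i.
  apply: (@toral_mx_inj _ _ P); rewrite -(conj_toral _ nuE) -frame_rowE conjE.
  by rewrite linear_sum; apply: eq_bigr => i _; rewrite linearZ frame_rowE.
pose R' : 'M[k]_n.+1 := \matrix_(a, c)
  if unlift ord_max a is Some i then
    (if unlift ord_max c is Some j then R i j else 0) else 0.
apply/matrixP => i j; rewrite [LHS]mxE.
suff E : col (lift ord_max j) (perm_mx s *m frame_mx) =
         frame_mx *m col (lift ord_max j) R'.
  have -> : C (lift ord_max i) (lift ord_max j) =
      (invmx frame_mx *m col (lift ord_max j) (perm_mx s *m frame_mx))
        (lift ord_max i) 0 by rewrite !colE mulmxA -colE [RHS]mxE.
  by rewrite E mulKmx ?frame_unit // !mxE !liftK.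
apply/colP => a; have /rowP/(_ a) := key j.
rewrite -col_permE summxE [LHS]mxE => keya.
rewrite [LHS]mxE -row_permE !mxE liftK keya (bigD1_ord ord_max) //=.
rewrite (_ : col _ R' ord_max 0 = 0) ?mulr0 ?add0r; last by rewrite !mxE unlift_none.
by apply: eq_bigr => l _; rewrite !mxE !liftK mulrC.
Qed.

Lemma frame_conj_unit : R \in unitmx.
Proof.
rewrite -frame_conj_upper_left unitmxE -det_upper_left // -unitmxE.
by rewrite !unitmx_mul unitmx_inv frame_unit unitmx_perm.
Qed.

(** The permutation multiplies the balanced frame on the left, and in the frame
    it is block triangular with leading block R. *)
Lemma slice_monomial g : generic P g ->
  GLmx (slice P frame_mx (nu * g)%g) = R *m GLmx (slice P frame_mx g).
Proof.
move=> gg; have fU := frame_unit; have fS := frame_sum.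
rewrite !sliceE //; last exact: generic_monomial nuE _ gg.
rewrite /slice_mx (balanced_monomial nuE) -frame_conj_upper_left -upper_leftM.
  by congr upper_left; rewrite /C -!mulmxA mulKVmx.
by move=> j; rewrite slice_last_row // eq_sym (negPf (neq_lift _ _)).
Qed.

End Conjugation.

Lemma weyl_representative (w : weyl_group P) :
  exists2 nu, normaliser P nu & \pi nu = val w.
Proof. exact: set_mem (valP w). Qed.

(** The matrix does not depend on the representative, because T is commutative. *)
Lemma exists_weyl_representation :
  exists rho : weyl_group P -> GL k n, weyl_representation b rho.
Proof.
suff ex (w : weyl_group P) : exists r : GL k n, forall nu : GL k n.+1,
    normaliser P nu -> \pi nu = val w ->
    forall j : 'I_n, GLmx nu *m b`_j *m GLmx nu^-1%g = \sum_(i < n) GLmx r i j *: b`_i.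
  by have [rho rhoE] := choice ex; exists rho.
have [nu0 N0 w0] := weyl_representative w.
have [s [e nuE]] := normaliser_monomial N0.
pose R : 'M[k]_n := \matrix_(i, j) coord b i (GLmx nu0 *m b`_j *m GLmx nu0^-1%g).
have RE (j : 'I_n) : GLmx nu0 *m b`_j *m GLmx nu0^-1%g = \sum_(i < n) R i j *: b`_i.
  under eq_bigr do rewrite mxE; apply: (coord_basis b_basis).
  rewrite frame_rowE (conj_toral _ nuE); apply/mem_cartan.
  exists (frame_row j *m perm_mx s^-1%g) => //.
  rewrite -col_permE -[RHS](frame_row_sum j) [RHS](reindex_inj (@perm_inj _ s)).
  by apply: eq_bigr => i _; rewrite mxE.
exists (GL_of_mx R) => nu Nnu nuw j; rewrite GL_of_mxK; last first.
  exact: frame_conj_unit nuE RE.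
have tT : (nu0^-1 * nu)%g \in torus P.
  by apply: (iffLR (pi_lcosetP (torus P) _ _)); rewrite w0 nuw.
have -> : nu = (nu0 * (nu0^-1 * nu))%g by rewrite mulVKg.
rewrite -RE; move: (nu0^-1 * nu)%g tT => t tT.
rewrite frame_rowE -[in RHS](conj_toral_torus (frame_row j) tT) invgM.
by rewrite (GLmxM nu0) (GLmxM t^-1%g) !mulmxA.
Qed.

End Frame.

(** * The weight of the theorem *)

Section RootCombination.
Variables (n : nat) (m : 'I_n -> nat).
Local Notation chi := (root_combination m).

Lemma root_combinationE j : chi 0 j =
  \sum_(i < n) ((j == lift ord_max i)%:R - (j == lift ord0 i)%:R) *+ m i.
Proof.
rewrite summxE; apply: eq_bigr => i _; rewrite mulmxnE; congr (_ *+ _).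
rewrite /simple_root !mxE !eqxx /=; congr ((j == _)%:R - _).
by apply: val_inj; exact: esym (lift_max i).
Qed.

Lemma root_combination_sum : \sum_j chi 0 j = 0.
Proof.
have E i : \sum_(j < n.+1) ((j == i)%:R : int) = 1.
  by rewrite (bigD1 i) //= eqxx big1 ?addr0 // => j /negPf ->.
under eq_bigr do rewrite root_combinationE.
rewrite exchange_big big1 // => i _.
by rewrite sumrMnl sumrB !E subrr mul0rn.
Qed.

Lemma coroot_pairingE (c : 'rV[int]_n.+1) i :
  coroot_pairing c i = c 0 (lift ord_max i) - c 0 (lift ord0 i).
Proof.
have wE : widen_ord (leqnSn n) i = lift ord_max i.
  by apply: val_inj; exact: esym (lift_max i).
have E l : \sum_(j < n.+1) c 0 j * (j == l)%:R = c 0 l.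
  rewrite (bigD1 l) //= eqxx mulr1 big1 ?addr0 // => j /negPf ->.
  by rewrite mulr0.
rewrite -!E -sumrB /coroot_pairing; apply: eq_bigr => j _.
by rewrite /simple_root !mxE !eqxx wE mulrBr.
Qed.

Hypothesis m_increasing : forall i j : 'I_n, j = i.+1 :> nat -> (m i < m j)%N.
Hypothesis chi_dominant : regular_dominant chi.

Lemma root_combination_decr i :
  chi 0 (lift ord0 i) < chi 0 (lift ord_max i).
Proof. by have := chi_dominant i; rewrite coroot_pairingE subr_gt0. Qed.

Lemma root_combination_succ (i j : 'I_n) : j = i.+1 :> nat ->
  chi 0 (lift ord_max j) = (m j)%:Z - (m i)%:Z.
Proof.
move=> ji; rewrite root_combinationE.
under eq_bigr do rewrite mulrnBl.
rewrite sumrB; congr (_ - _).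
  rewrite (bigD1 j) //= eqxx big1 ?addr0 ?natz // => l lj.
  by rewrite (inj_eq lift_inj) eq_sym (negPf lj) mul0rn.
have E l : (lift ord_max j == lift ord0 l) = (l == i).
  by rewrite -!val_eqE /= /bump leqNgt ltn_ord add0n leq0n add1n ji eqSS eq_sym.
rewrite (bigD1 i) //= E eqxx big1 ?addr0 ?natz // => l li.
by rewrite E (negPf li) mul0rn.
Qed.

(** For i > 0 the entry is m_i - m_(i-1).  The entry of index 0 exceeds the next
    one, by dominance, which is positive when n > 1; when n = 1 the two entries
    are opposite. *)
Lemma root_combination_pos i : 0 < chi 0 (lift ord_max i).
Proof.
have pos_succ (a j : 'I_n) : j = a.+1 :> nat -> 0 < chi 0 (lift ord_max j).
  move=> ja; rewrite (root_combination_succ ja) subr_gt0 ltz_nat.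
  exact: m_increasing.
case: i => [[|a] an]; last first.
  by apply: (pos_succ (Ordinal (ltnW an)) (Ordinal an)).
have lt := root_combination_decr (Ordinal an).
have [n1|n1] := ltnP 1 n.
  apply: Order.POrderTheory.lt_trans lt.
  rewrite (_ : lift ord0 _ = lift ord_max (Ordinal n1)).
    exact: (pos_succ (Ordinal an)).
  by apply: val_inj; exact: esym (lift_max (Ordinal n1)).
have nE : n = 1%N by apply/eqP; rewrite eqn_leq n1.
have lE : lift ord0 (Ordinal an) = ord_max.
  by apply: val_inj; rewrite /= nE.
have := root_combination_sum; rewrite (bigD1_ord ord_max) //=.
rewrite (bigD1 (Ordinal an)) //= big1 => [|l]; last first.
  by rewrite -val_eqE /= -lt0n => l0; have := ltn_ord l; rewrite ltnNge (leq_trans n1).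
rewrite addr0 => /eqP; rewrite addr_eq0 => /eqP E; move: lt; rewrite lE.
by rewrite E -subr_gt0 opprK -mulr2n pmulrn_lgt0.
Qed.

End RootCombination.

Theorem corollary5p4 (k : closedFieldType) (n : nat) (P : GL k n.+1)
    (m : 'I_n -> nat) (n_gt0 : (0 < n)%N)
    (chi_dominant : regular_dominant (root_combination m))
    (m_increasing : forall i j : 'I_n, j = i.+1 :> nat -> (m i < m j)%N) :
  \dim (cartan_subalgebra P) = n /\
  (exists (Y : spaceWithFunctions k)
          (pi : semistable P (root_combination m) -> Y), is_GIT_quotient pi) /\
  (forall (Y : spaceWithFunctions k)
          (pi : semistable P (root_combination m) -> Y),
    is_GIT_quotient pi ->
    exists2 act : weyl_group P -> Y -> Y, induced_action pi act &
    forall b : n.-tuple 'M[k]_n.+1, basis_of (cartan_subalgebra P) b ->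
    exists2 rho : weyl_group P -> GL k n, weyl_representation b rho &
    exists2 phi : Y -> homogeneous_space (borel_sub P), isomorphism phi &
    forall (w : weyl_group P) (y : Y), phi (act w y) = translate (rho w) (phi y)).
Proof.
have chi_sum := root_combination_sum m.
have chi_pos := root_combination_pos m_increasing chi_dominant.
have chi_decr := root_combination_decr chi_dominant.
have ssP g : semistable P (root_combination m)
    (\pi_(homogeneous_space (borel P)) g) <-> generic P g.
  split; first exact: semistable_generic.
  apply: generic_semistable => // i; exact: Order.POrderTheory.ltW.
split; first exact: dim_cartan.
(* The construction works for every frame D; existence uses one, and the
   comparison with a basis b of the Cartan subalgebra uses the frame of b. *)
have gq D (D_unit : D \in unitmx)
    (D_sum : const_mx 1 *m D = delta_mx 0 ord_max :> 'rV_n.+1) :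
    is_GIT_quotient (quotient_map D : semistable P (root_combination m) -> _).
  apply: (@good_quotient_section _ _ _ _ _ (quotient_section ssP D_unit D_sum)).
  - exact: quotient_map_morphism.
  - exact: quotient_section_morphism.
  - exact: quotient_sectionK.
  - exact: quotient_map_invariant.
  - exact: quotient_map_orbit.
  - exact: quotient_map_affine.
have [b0 b0P] := exists_cartan_basis P.
split.
  exists (homogeneous_space (borel_sub P)), (quotient_map (frame_mx b0P)).
  by apply: gq; [exact: frame_unit | exact: frame_sum].
move=> Y pi piP.
have iso (b : n.-tuple 'M[k]_n.+1) (bP : basis_of (cartan_subalgebra P) b) :
    exists2 phi : Y -> homogeneous_space (borel_sub P), isomorphism phi &
      forall x, phi (pi x) = quotient_map (frame_mx bP) x.
  have fU := frame_unit bP; have fS := frame_sum bP.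
  apply: (@good_quotient_unique _ _ _ (@torus_orbit _ _ P _)
    (quotient_map (frame_mx bP)) (quotient_section ssP fU fS)).
  - exact: quotient_map_morphism.
  - exact: quotient_section_morphism.
  - exact: quotient_sectionK.
  - exact: quotient_map_invariant.
  - exact: quotient_map_orbit.
  - exact: closed_point.
  - exact: piP.
have move_ss (nu : GL k n.+1) (x : semistable P (root_combination m)) :
    normaliser P nu -> exists x' : semistable P (root_combination m),
      val x' = translate nu (val x).
  move=> /normaliser_monomial[s [e nuE]].
  have ss : translate nu (val x) \in semistable P (root_combination m).
    apply/mem_set/ssP; apply: (generic_monomial nuE); exact: generic_repr.
  by exists (exist _ (translate nu (val x)) ss).
have equivariant (b : n.-tuple 'M[k]_n.+1) (bP : basis_of (cartan_subalgebra P) b)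
    (rho : weyl_group P -> GL k n) (w : weyl_group P) nu
    (x x' : semistable P (root_combination m)) :
    weyl_representation b rho -> normaliser P nu -> \pi nu = val w ->
    val x' = translate nu (val x) ->
    quotient_map (frame_mx bP) x' =
    translate (rho w) (quotient_map (frame_mx bP) x).
  move=> rhoP Nnu nuw x'E; have fU := frame_unit bP; have fS := frame_sum bP.
  have [g xg] : exists g, val x = \pi_(homogeneous_space (borel P)) g.
    by exists (repr (val x)); rewrite reprK.
  have gg := generic_pi ssP xg; move: x'E; rewrite xg translate_pi => x'g.
  rewrite (quotient_mapE ssP fU fS xg) (quotient_mapE ssP fU fS x'g) translate_pi.
  congr (\pi_(homogeneous_space (borel_sub P)) _).
  apply: GLmx_inj; rewrite GLmxM.
  have [s [e nuE]] := normaliser_monomial Nnu.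
  exact: (slice_monomial bP nuE (rhoP w nu Nnu nuw) gg).
(* The action on Y must not depend on b: it is transported from the slice of
   one auxiliary basis b0.  Equivariance of the quotient map shows that it is
   the action induced from N, and this determines it for every other b. *)
have [rho0 rho0P] := exists_weyl_representation b0P.
have [phi0 [_ [psi0 [_ phi0K psi0K]]] phi0E] := iso _ b0P.
pose act w y := psi0 (translate (rho0 w) (phi0 y)).
have actE w nu x x' : normaliser P nu -> \pi nu = val w ->
    val x' = translate nu (val x) -> act w (pi x) = pi x'.
  move=> Nnu nuw x'E; rewrite /act phi0E -(equivariant _ b0P _ _ _ _ _ rho0P Nnu nuw x'E).
  by rewrite -phi0E phi0K.
exists act.
  move=> w nu Nnu nuw x; have [x' x'E] := move_ss nu x Nnu.
  by exists x' => //; exact: actE nuw x'E.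
move=> b bP; have [rho rhoP] := exists_weyl_representation bP.
exists rho => //; have [phi phi_iso phiE] := iso _ bP.
exists phi => // w y.
have [x <-] := good_quotient_surj piP y.
have [nu Nnu nuw] := weyl_representative w.
have [x' x'E] := move_ss nu x Nnu.
by rewrite (actE w nu x x') // !phiE; exact: equivariant rhoP Nnu nuw x'E.
Qed.
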